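(* (i) For a decreasing $\Lambda:\mathbb{R}\to(0,1]$, $\mathrm{ES}_\Lambda=\min\{\rho:L^1\to\overline{\mathbb{R}}\mid\rho\ge\mathrm{VaR}_\Lambda\text{ and }\rho\text{ is quasi-convex and law invariant}\}$. (ii) For a decreasing $\Lambda:\mathbb{R}\to(0,1)$, $\mathrm{ES}_\Lambda=\min\{\rho:L^1\to\overline{\mathbb{R}}\mid\rho\ge\mathrm{VaR}^+_\Lambda\text{ and }\rho\text{ is quasi-convex and law invariant}\}$. (iii) For a decreasing $\Lambda:\mathbb{R}\to[0,1)$, $\mathrm{ES}_\Lambda=\min\{\rho:\underline{L}^1\to\overline{\mathbb{R}}\mid\rho\ge\mathrm{VaR}^+_\Lambda\text{ and }\rho\text{ is quasi-convex and law invariant}\}$ (with $\mathrm{ES}_\Lambda$ restricted to $\underline{L}^1$). Here ''min'' means that $\mathrm{ES}_\Lambda$ belongs to the set and is pointwise $\le$ every element of it. Moreover, for every decreasing $\Lambda:\mathbb{R}\to[0,1]$, $$\mathrm{ES}_\Lambda(X)=\inf_{x\in\mathbb{R}}\left(\mathrm{ES}_{\Lambda(x)}(X)\vee x\right),\quad X\in L^1.$$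
   Context: $(\Omega,\mathcal F,\mathbb P)$ is an atomless probability space, $L^0$ all random variables, $L^1$ integrable ones, $\underline{L}^1$ the elements of $L^1$ essentially bounded from below; $\overline{\mathbb{R}}=[-\infty,\infty]$; ''decreasing'' is weak; $\wedge=\min$, $\vee=\max$. For $\alpha\in[0,1]$, $X\in L^0$: $\mathrm{VaR}_\alpha(X)=\inf\{x\in\mathbb{R}:\mathbb P(X\le x)\ge\alpha\}$, $\mathrm{VaR}^+_\alpha(X)=\inf\{x\in\mathbb{R}:\mathbb P(X\le x)>\alpha\}$. For $X\in L^1$: $\mathrm{ES}_\alpha(X)=\frac{1}{1-\alpha}\int_\alpha^1\mathrm{VaR}_\beta(X)\,\mathrm d\beta$ for $\alpha<1$, $\mathrm{ES}_1(X)=\mathrm{VaR}_1(X)$. For decreasing $\Lambda:\mathbb{R}\to[0,1]$: $\mathrm{VaR}_\Lambda(X)=\inf\{x\in\mathbb{R}:\mathbb P(X\le x)\ge\Lambda(x)\}$, $\mathrm{VaR}^+_\Lambda(X)=\inf\{x\in\mathbb{R}:\mathbb P(X\le x)>\Lambda(x)\}$, $\mathrm{ES}_\Lambda(X)=\sup_{x\in\mathbb{R}}\left(\mathrm{ES}_{\Lambda(x)}(X)\wedge x\right)$, $X\in L^1$. Quasi-convex: $\rho(\gamma X+(1-\gamma)Y)\le\max\{\rho(X),\rho(Y)\}$; law invariant: $\rho(X)=\rho(Y)$ for equally distributed $X,Y$. *)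

(* Defs.v *)
From HB Require Import structures.
From mathcomp Require Import all_boot all_order all_algebra.
From mathcomp Require Import all_classical all_reals all_analysis.
Set Implicit Arguments. Unset Strict Implicit. Unset Printing Implicit Defensive.
Import Order.TTheory GRing.Theory Num.Theory.
Local Open Scope classical_set_scope.
Local Open Scope ring_scope.
Local Open Scope ereal_scope.

Section RiskMeasures.
Context {d : measure_display} {T : measurableType d} {R : realType}
  (P : probability T R).

Definition atomless : Prop :=
  forall A : set T, measurable A -> (0 < P A)%E ->
    exists2 B : set T, measurable B /\ B `<=` A & (0 < P B)%E /\ (P B < P A)%E.

Definition L0 (X : T -> R) : Prop := measurable_fun setT X.
Definition L1 (X : T -> R) : Prop := P.-integrable setT (EFin \o X).
Definition L1b (X : T -> R) : Prop :=
  L1 X /\ exists c : R, {ae P, forall t, (c <= X t)%R}.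

Definition same_law (X Y : T -> R) : Prop :=
  forall B : set R, measurable B -> P (X @^-1` B) = P (Y @^-1` B).

Definition cdf (X : T -> R) (x : R) : \bar R := P [set t | (X t <= x)%R].

Definition VaR (a : R) (X : T -> R) : \bar R :=
  ereal_inf [set x%:E | x in [set x : R | (a%:E <= cdf X x)%E]].
Definition VaRp (a : R) (X : T -> R) : \bar R :=
  ereal_inf [set x%:E | x in [set x : R | (a%:E < cdf X x)%E]].

Definition ES (a : R) (X : T -> R) : \bar R :=
  if (a < 1)%R then
    ((1 - a)^-1)%:E * \int[@lebesgue_measure R]_(b in `]a, 1%R[%classic) VaR b X
  else VaR 1 X.

Definition VaRL (L : R -> R) (X : T -> R) : \bar R :=
  ereal_inf [set x%:E | x in [set x : R | ((L x)%:E <= cdf X x)%E]].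
Definition VaRpL (L : R -> R) (X : T -> R) : \bar R :=
  ereal_inf [set x%:E | x in [set x : R | ((L x)%:E < cdf X x)%E]].

Definition ESL (L : R -> R) (X : T -> R) : \bar R :=
  ereal_sup [set mine (ES (L x) X) x%:E | x in [set: R]].

Definition quasi_convex_on (D : (T -> R) -> Prop) (rho : (T -> R) -> \bar R) :=
  forall X Y, D X -> D Y -> forall g : R, (0 <= g <= 1)%R ->
    rho (fun t => g * X t + (1 - g) * Y t)%R <= maxe (rho X) (rho Y).

Definition law_invariant_on (D : (T -> R) -> Prop) (rho : (T -> R) -> \bar R) :=
  forall X Y, D X -> D Y -> same_law X Y -> rho X = rho Y.

Definition dominates_on (D : (T -> R) -> Prop) (rho f : (T -> R) -> \bar R) :=
  forall X, D X -> f X <= rho X.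

Definition admissible (D : (T -> R) -> Prop) (f rho : (T -> R) -> \bar R) :=
  [/\ dominates_on D rho f, quasi_convex_on D rho & law_invariant_on D rho].

Definition is_min_admissible (D : (T -> R) -> Prop) (f rho0 : (T -> R) -> \bar R) :=
  admissible D f rho0 /\
  forall rho, admissible D f rho -> forall X, D X -> rho0 X <= rho X.

End RiskMeasures.

Definition decreasing {R : realType} (L : R -> R) : Prop :=
  forall x y : R, (x <= y)%R -> (L y <= L x)%R.

(* Main.v *)
(* Two facts about ES_a give everything except minimality. It is increasing in
   the level a, so x |-> ES_(L x)(X) is decreasing and its graph crosses the
   diagonal, whence sup-min = inf-max. It is quasi-convex (by the
   Rockafellar-Uryasev formula ES_a(X) = min_x (x + E(X - x)^+ / (1 - a))), and
   min(., x) followed by a supremum preserves quasi-convexity.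

   Minimality. Let r < ES_L(X) and a := L r; then r < ES_a(X). An atomless space
   carries a uniform variable U, and X has the law of q(U), q being the quantile
   function of X. Rotating U inside [b, 1[ by multiples of (1 - b) / n gives n
   variables with the law of X whose average is, on the event U >= b, a Riemann
   sum of q over [b, 1[, hence eventually > r as soon as ES_b(X) > r and q is
   bounded below on [b, 1[. That average Z satisfies P(Z <= r) <= b and, by
   quasi-convexity and law invariance, rho(Z) <= rho(X). One takes b slightly
   below a when a > 0, so that VaR_L(Z) >= r, and b = 0 when a = 0; the latter
   requires X to be bounded below and gives VaR^+_L(Z) >= r. *)

Require Import Defs.
From HB Require Import structures.
From mathcomp Require Import all_boot all_order all_algebra.
From mathcomp Require Import all_classical all_reals all_analysis.
From mathcomp Require Import measurable_realfun ring lra.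
Set Implicit Arguments.
Unset Strict Implicit.
Unset Printing Implicit Defensive.
Import Order.TTheory GRing.Theory Num.Theory.
Import numFieldNormedType.Exports.
Local Open Scope classical_set_scope.
Local Open Scope ring_scope.

(** * Uniform random variables on atomless spaces *)

Lemma measurable_le_cst d (T : measurableType d) (R : realType) (f : T -> R)
  (y : R) : measurable_fun setT f -> measurable [set t | f t <= y].
Proof.
move=> mf; rewrite -[X in measurable X]setTI (_ : [set t | _] = f @^-1` `]-oo, y]).
  exact: mf.
by apply/seteqP; split => t /=; rewrite in_itv.
Qed.

Lemma measurable_lt_cst d (T : measurableType d) (R : realType) (f : T -> R)
  (y : R) : measurable_fun setT f -> measurable [set t | f t < y].
Proof.
move=> mf; rewrite -[X in measurable X]setTI (_ : [set t | f t < y] = f @^-1` `]-oo, y[).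
  exact: mf.
by apply/seteqP; split => t /=; rewrite in_itv.
Qed.

Section RealProbability.
Context {d : measure_display} {T : measurableType d} {R : realType}
  (P : probability T R).
Implicit Types A B C : set T.

Definition pr A : R := fine (P A).

Lemma prE A : measurable A -> P A = (pr A)%:E.
Proof. by move=> mA; rewrite /pr fineK// fin_num_measure. Qed.

Lemma pr_ge0 A : 0 <= pr A. Proof. by rewrite fine_ge0. Qed.

Lemma pr0 : pr set0 = 0. Proof. by rewrite /pr measure0. Qed.

Lemma prT : pr setT = 1. Proof. by rewrite /pr probability_setT. Qed.

Lemma le_pr A B : measurable A -> measurable B -> A `<=` B -> pr A <= pr B.
Proof.
by move=> mA mB AB; rewrite -lee_fin -!prE// le_measure// inE.
Qed.

Lemma prU A B : measurable A -> measurable B -> A `&` B = set0 ->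
  pr (A `|` B) = pr A + pr B.
Proof.
move=> mA mB AB; apply: EFin_inj; rewrite EFinD -!prE//; last exact: measurableU.
by rewrite measureU.
Qed.

Lemma prD A B : measurable A -> measurable B -> A `<=` B ->
  pr (B `\` A) = pr B - pr A.
Proof.
move=> mA mB AB; have mD : measurable (B `\` A) by exact: measurableD.
by rewrite -{2}(setDUK AB) prU ?setDIK// addrC addKr.
Qed.

Lemma pr_bigcup_le (F : (set T)^nat) (t : R) : (forall n, measurable (F n)) ->
  nondecreasing_seq F -> (forall n, pr (F n) <= t) -> pr (\bigcup_n F n) <= t.
Proof.
move=> mF ndF Ft.
have mU : measurable (\bigcup_n F n) by exact: bigcup_measurable.
rewrite -lee_fin -prE//.
have /cvg_lim <- // := nondecreasing_cvg_mu (mu := P) mF mU ndF.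
apply: lime_le.
  apply: ereal_nondecreasing_is_cvgn => n m nm.
  by rewrite le_measure ?inE//; exact/subsetPset/ndF.
by near=> n; rewrite /= prE// lee_fin.
Unshelve. all: by end_near. Qed.

(** [{V <= x}] lies between [{V < x}] and [{V < x + e}], with [x + e] capped at 1, where the
    hypothesis stops. Uniformity is obtained on strict sublevel sets and used on weak ones. *)
Lemma pr_lt_le (V : T -> R) : measurable_fun setT V ->
  (forall x, 0 < x <= 1 -> pr [set w | V w < x] = x) ->
  forall x, 0 <= x <= 1 -> pr [set w | V w <= x] = x.
Proof.
move=> mV hV x /andP[x0 x1].
have mle y : measurable [set w | V w <= y] by exact: measurable_le_cst.
have mlt y : measurable [set w | V w < y] by exact: measurable_lt_cst.
apply/eqP; rewrite eq_le; apply/andP; split.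
  have [->|x1'] := eqVneq x 1; first by rewrite -prT le_pr.
  apply/ler_addgt0Pr => e e0; pose y := Num.min (x + e) 1.
  have yxe : y <= x + e by rewrite ge_min lexx.
  have xy : x < y by rewrite lt_min ltrDl e0 lt_neqAle x1'.
  have y1 : y <= 1 by rewrite ge_min lexx orbT.
  apply: le_trans yxe; rewrite -[leRHS]hV ?y1 ?andbT ?(le_lt_trans x0)//.
  by apply: le_pr => // w /= /le_lt_trans; exact.
have [->|x0'] := eqVneq x 0; first exact: pr_ge0.
rewrite -[leLHS]hV ?x1 ?andbT ?lt_neqAle 1?eq_sym ?x0'//.
by apply: le_pr => // w /= /ltW.
Qed.

(* Greedy choice: each set of the sequence almost realises the supremum of the
   probabilities of the members of F above its predecessor. *)
Lemma maximal_exhaustion (F : set (set T)) : F !=set0 ->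
  (forall A, F A -> measurable A) ->
  (forall G : (set T)^nat, (forall n, F (G n)) -> nondecreasing_seq G ->
    F (\bigcup_n G n)) ->
  exists2 M, F M & forall A, F A -> M `<=` A -> pr A <= pr M.
Proof.
move=> [A0 FA0] mF cF.
have step n A : F A -> exists B, [/\ F B, A `<=` B &
    forall C, F C -> A `<=` C -> pr C <= pr B + n.+1%:R^-1].
  move=> FA; pose S := [set pr C | C in [set C | F C /\ A `<=` C]].
  have supS : has_sup S.
    split; first by exists (pr A); exists A => //; split.
    by exists 1 => _ [C [FC _] <-]; rewrite -prT le_pr//; exact: mF.
  have n0 : 0 < n.+1%:R^-1 :> R by rewrite invr_gt0.
  have [_ [B [FB AB] <-] SB] := sup_adherent n0 supS.
  exists B; split => // C FC AC.
  have : pr C <= sup S by apply: sup_ubound; [exact: supS.2|exists C].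
  by move=> /le_trans; apply; rewrite -lerBlDr ltW.
pose next n A := xget A0 [set B | F A -> [/\ F B, A `<=` B &
    forall C, F C -> A `<=` C -> pr C <= pr B + n.+1%:R^-1]].
have nextP n A : F A -> [/\ F (next n A), A `<=` next n A &
    forall C, F C -> A `<=` C -> pr C <= pr (next n A) + n.+1%:R^-1].
  move=> FA; have [B HB] := step n A FA.
  by apply: (@xgetPex _ A0 _ (ex_intro _ B (fun _ => HB))).
pose G := fix G n := if n is m.+1 then next m (G m) else A0.
have FG n : F (G n) by elim: n => // n IH /=; have [] := nextP n _ IH.
have GS n : G n `<=` G n.+1 by have [] := nextP n _ (FG n).
have FM : F (\bigcup_n G n).
  by apply: cF => //; apply/nondecreasing_seqP => n; exact/subsetPset.
exists (\bigcup_n G n) => // A FA MA.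
apply/ler_addgt0Pr => e e0.
have [n ne] : exists n : nat, n.+1%:R^-1 < e.
  by have [n _ /(_ n (leqnn n))] := near_infty_natSinv_lt (PosNum e0); exists n.
have [_ _ /(_ A FA)] := nextP n _ (FG n).
have /[swap]/[apply] : G n `<=` A by apply: subset_trans MA => x Gx; exists n.
move=> /le_trans; apply; apply: lerD; last exact: ltW.
apply: le_pr; [exact/mF/(FG n.+1)|exact: mF|].
by move=> x Gx; exists n.+1.
Qed.

(** * Events of prescribed probability in an atomless space *)

Hypothesis HP : atomless P.

(** When an event splits into two parts of positive probability, one of them has at most half of it.
    Halving [n] times leaves at most [2 ^- n], and [n] is taken with [2 ^- n < e]. *)
Lemma atomless_small A (e : R) : measurable A -> 0 < pr A -> 0 < e ->
  exists B, [/\ measurable B, B `<=` A, 0 < pr B & pr B < e].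
Proof.
move=> mA A0 e0.
have half C : measurable C -> 0 < pr C -> exists B,
    [/\ measurable B, B `<=` C, 0 < pr B & 2 * pr B <= pr C].
  move=> mC C0; have [|B [mB BC]] := HP mC; first by rewrite prE// lte_fin.
  rewrite !prE// !lte_fin => -[B0 B1].
  have mCB : measurable (C `\` B) by exact: measurableD.
  have := prD mB mC BC.
  have [h|h] := leP (2 * pr B) (pr C) => CB; first by exists B.
  exists (C `\` B); split => //; move: h B1; rewrite CB; lra.
have [n] : exists n, forall C, measurable C -> 0 < pr C ->
    exists B, [/\ measurable B, B `<=` C, 0 < pr B &
      2 ^+ n * pr B <= pr C] /\ 1 < 2 ^+ n * e.
  pose n := Num.trunc e^-1.
  have ne : 1 < 2 ^+ n.+1 * e.
    have : e^-1 < n.+1%:R by rewrite /n truncnS_gt.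
    rewrite -ltr_pdivrMr// mul1r => /lt_le_trans; apply.
    by rewrite -natrX ler_nat ltnW// ltn_expl.
  exists n.+1; move: {n}n.+1 ne => n ne C mC C0.
  suff [B HB] : exists B, [/\ measurable B, B `<=` C, 0 < pr B &
    2 ^+ n * pr B <= pr C] by exists B.
  elim: n {ne} => [|n [B [mB BC B0 nB]]]; first by exists C; split; rewrite ?expr0 ?mul1r.
  have [D [mD DB D0 hD]] := half B mB B0.
  exists D; split => //; first exact: subset_trans DB BC.
  by rewrite exprSr -mulrA (le_trans _ nB)// ler_wpM2l// exprn_ge0.
move=> /(_ A mA A0) [B [[mB BA B0 nB] ne]]; exists B; split => //.
have A1 : pr A <= 1 by rewrite -prT le_pr.
by rewrite -(@ltr_pM2l _ (2 ^+ n)) ?exprn_gt0//; lra.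
Qed.

(** Sierpinski's theorem. A maximal event [M] between [A] and [B] of probability at most [t] must
    reach [t]: otherwise a piece of the rest of [B], of positive probability below [t - pr M], could
    be added. *)
Lemma atomless_interpolation A B (t : R) : measurable A -> measurable B ->
  A `<=` B -> pr A <= t <= pr B ->
  exists C, [/\ measurable C, A `<=` C, C `<=` B & pr C = t].
Proof.
move=> mA mB AB /andP[At tB].
pose F := [set C | [/\ measurable C, A `<=` C, C `<=` B & pr C <= t]].
have [||G FG ndG|M [mM AM MB Mt] maxM] := @maximal_exhaustion F.
- by exists A; split.
- by move=> C [].
- split.
  + by apply: bigcup_measurable => n _; have [] := FG n.
  + by move=> x Ax; exists 0 => //; have [_ + _ _] := FG 0; exact.
  + by move=> x [n _]; have [_ _ + _] := FG n; exact.
  + by apply: pr_bigcup_le => // n; have [] := FG n.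
exists M; split => //; apply/eqP; rewrite eq_le Mt/= leNgt; apply/negP => Mlt.
have mBM : measurable (B `\` M) by exact: measurableD.
have [||C [mC CBM C0 Ct]] := @atomless_small (B `\` M) (t - pr M) mBM.
- by rewrite prD//; lra.
- by lra.
have MC : pr (M `|` C) = pr M + pr C.
  by rewrite prU//; rewrite -subset0 => x [Mx /CBM[]].
have : pr (M `|` C) <= pr M.
  apply: maxM; last exact: subsetUl.
  split; [exact: measurableU|by move=> x /AM; left| |by lra].
  by move=> x [/MB//|/CBM[]].
by lra.
Qed.

(** * A dyadic chain of events and the uniform variable it defines *)

Definition midset A B : set T :=
  xget set0 [set C | [/\ measurable C, A `<=` C, C `<=` B &
                         pr C = (pr A + pr B) / 2]].

(* An increasing chain in k, of probability min(k / 2^n, 1); level n.+1 refines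
   level n, whose sets are those of even index. *)
Fixpoint dyadic_chain n k : set T :=
  if n is m.+1 then
    if odd k then midset (dyadic_chain m k./2) (dyadic_chain m k./2.+1)
    else dyadic_chain m k./2
  else if k is 0 then set0 else setT.

Lemma midsetP A B : measurable A -> measurable B -> A `<=` B ->
  [/\ measurable (midset A B), A `<=` midset A B, midset A B `<=` B &
      pr (midset A B) = (pr A + pr B) / 2].
Proof.
move=> mA mB AB.
have [|C HC] := @atomless_interpolation A B ((pr A + pr B) / 2) mA mB AB.
  by have := le_pr mA mB AB; lra.
by rewrite /midset; case: xgetP => [D _ //|/(_ C)].
Qed.

(** The facts are proved together because [midsetP] at one level needs measurability and inclusion
    at the previous one. Indices beyond [2 ^ n] are allowed and give sets of probability 1. *)
Lemma dyadic_chainP n :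
  [/\ forall k, measurable (dyadic_chain n k),
      forall k, dyadic_chain n k `<=` dyadic_chain n k.+1,
      forall k, (k <= 2 ^ n)%N -> pr (dyadic_chain n k) = k%:R / 2 ^+ n &
      forall k, (2 ^ n <= k)%N -> pr (dyadic_chain n k) = 1].
Proof.
elim: n => [|n [mD sD pD qD]].
  split => [[|k]|[|k]|[|[|k]]|[|k]]//=; try by [rewrite pr0 mul0r|rewrite prT ?divr1].
have M k := midsetP (mD k) (mD k.+1) (sD k).
split => k /=.
- by case: ifP => _; [have [] := M k./2|exact: mD].
- have [ok|ek] /= := boolP (odd k).
    by rewrite uphalf_half ok; have [] := M k./2.
  by rewrite uphalf_half (negbTE ek); have [] := M k./2.
- move=> kn; have k2 := odd_double_half k.
  have [ok|ek] := boolP (odd k); rewrite -[in RHS]k2 -muln2.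
    have [_ _ _ ->] := M k./2.
    move: kn; rewrite -{1}k2 ok -muln2 expnSr => kn.
    have kn' : (k./2 < 2 ^ n)%N.
      by rewrite -(ltn_pmul2r (ltn0Sn 1)); apply: leq_trans kn; rewrite addnC addn1.
    rewrite !pD//; last exact: ltnW.
    rewrite (natrD _ true) natrM -[_.+1%:R]natr1 exprSr /=.
    by field; rewrite expf_neq0.
  rewrite (negbTE ek) add0n natrM pD ?exprSr; first by field; rewrite expf_neq0.
  move: kn; rewrite -{1}k2 (negbTE ek) add0n -muln2 expnSr leq_pmul2r//.
- move=> kn.
  have hk : (2 ^ n <= k./2)%N by have := half_leq kn; rewrite expnS mul2n doubleK.
  have [ok|ek] := boolP (odd k); last exact: qD.
  by have [_ _ _ ->] := M k./2; rewrite !qD ?(leq_trans hk)//; lra.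
Qed.


Lemma dyadic_chain_mono n : {homo dyadic_chain n : j k / (j <= k)%N >-> j `<=` k}.
Proof.
have [_ sD _ _] := dyadic_chainP n.
by apply: homo_leq => // [A x|B A C AB BC]; [|exact: subset_trans BC].
Qed.

Lemma dyadic_chain_refine n m k :
  dyadic_chain (n + m) (k * 2 ^ m) = dyadic_chain n k.
Proof.
elim: m => [|m IH]; first by rewrite addn0 muln1.
by rewrite addnS /= expnSr mulnA muln2 odd_double doubleK.
Qed.

(** The hypothesis reads [j / 2 ^ n <= k / 2 ^ m], and both sets belong to the increasing chain of
    level [n + m]. *)
Lemma dyadic_chain_sub n m j k : (j * 2 ^ m <= k * 2 ^ n)%N ->
  dyadic_chain n j `<=` dyadic_chain m k.
Proof.
move=> jk; rewrite -(dyadic_chain_refine n m j) -(dyadic_chain_refine m n k) addnC.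
exact: dyadic_chain_mono.
Qed.

(** The generalised inverse of the chain: the dyadic time at which [w] enters it. The infimum is
    genuine, since 1 always belongs to the set ([dyadic_chain 0 1] is the whole space) and 0 is a
    lower bound. *)
Definition uniform_rv (w : T) : R :=
  inf [set x | exists n k, x = k%:R / 2 ^+ n /\ dyadic_chain n k w].

(** A strict upper bound on an infimum passes to some member of the set. Strict sublevel sets are
    therefore countable unions of chain sets. *)
Lemma uniform_rv_lt (x : R) w :
  uniform_rv w < x <-> exists n k, k%:R / 2 ^+ n < x /\ dyadic_chain n k w.
Proof.
rewrite /uniform_rv; set S := [set x | _].
have hS : has_inf S.
  split; first by exists 1; exists 0%N, 1%N; rewrite divr1.
  by exists 0 => _ [n [k [-> _]]]; rewrite divr_ge0// exprn_ge0.
split=> [xw|[n [k [kx wk]]]].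
  have xS : 0 < x - inf S by rewrite subr_gt0.
  have [_ [n [k [-> wk]]] lt] := inf_adherent xS hS.
  by exists n, k; split => //; move: lt; rewrite -/(uniform_rv w) addrC subrK.
apply: le_lt_trans kx; apply: inf_lbound; first exact: hS.2.
by exists n, k.
Qed.

Lemma uniform_rv_setE (x : R) : [set w | uniform_rv w < x] =
  \bigcup_n \bigcup_(k in [set k : nat | k%:R / 2 ^+ n < x]) dyadic_chain n k.
Proof.
apply/seteqP; split=> w /=.
  by move=> /uniform_rv_lt[n [k [kx wk]]]; exists n => //; exists k.
by move=> [n _ [k kx wk]]; apply/uniform_rv_lt; exists n, k.
Qed.

Lemma measurable_uniform_rv_lt (x : R) : measurable [set w | uniform_rv w < x].
Proof.
rewrite uniform_rv_setE; apply: bigcup_measurable => n _.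
by apply: bigcup_measurable => k _; have [] := dyadic_chainP n.
Qed.

Lemma measurable_uniform_rv : measurable_fun setT uniform_rv.
Proof.
apply: (measurability _ (RGenInftyO.measurableE R)) => _ [_ [x ->] <-].
rewrite setTI (_ : _ @^-1` _ = [set w | uniform_rv w < x]).
  exact: measurable_uniform_rv_lt.
by apply/seteqP; split => w /=; rewrite in_itv.
Qed.

Lemma dyadic_approx (x e : R) : 0 < x -> 0 < e ->
  exists n k, [/\ k%:R / 2 ^+ n < x, x <= k.+1%:R / 2 ^+ n &
    k.+1%:R / 2 ^+ n <= k%:R / 2 ^+ n + e].
Proof.
move=> x0 e0; pose n := Num.trunc e^-1.
have n0 : 0 < 2 ^+ n.+1 :> R by rewrite exprn_gt0.
have ne : 1 / 2 ^+ n.+1 <= e.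
  rewrite ler_pdivrMr// -ler_pdivrMl// mulr1.
  have : e^-1 < n.+1%:R by rewrite /n truncnS_gt.
  by move=> /ltW/le_trans; apply; rewrite -natrX ler_nat ltnW// ltn_expl.
(* [k.+1] is the least natural number not below [x * 2 ^+ n.+1]; it is not 0 because [x] is
   positive. *)
have [k [k1 k2]] : exists k : nat, k%:R < x * 2 ^+ n.+1 /\ x * 2 ^+ n.+1 <= k.+1%:R.
  have xn : 0 < x * 2 ^+ n.+1 by rewrite mulr_gt0.
  have ex : exists k : nat, x * 2 ^+ n.+1 <= k%:R.
    by exists (Num.trunc (x * 2 ^+ n.+1)).+1; rewrite ltW// truncnS_gt.
  have [[|k] km kmin] := ex_minnP ex; first by move: km; rewrite leNgt xn.
  by exists k; split => //; rewrite ltNge; apply/negP => /kmin; rewrite ltnn.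
exists n.+1, k; split; rewrite ?ltr_pdivrMr ?ler_pdivlMr//.
by rewrite -natr1 mulrDl lerD2l.
Qed.

(** With [k / 2 ^ n < x <= k.+1 / 2 ^ n], the event contains the chain set of index [k] and is
    contained in that of index [k.+1]. Their probabilities are within [e] of [x] on a fine enough
    level. *)
Lemma pr_uniform_rv_lt (x : R) : 0 < x <= 1 -> pr [set w | uniform_rv w < x] = x.
Proof.
move=> /andP[x0 x1]; have mS := measurable_uniform_rv_lt x.
have expn0 n : 0 < 2 ^+ n :> R by rewrite exprn_gt0.
have pD n k : k%:R / 2 ^+ n <= 1 :> R -> pr (dyadic_chain n k) = k%:R / 2 ^+ n.
  have [_ _ + _] := dyadic_chainP n.
  by rewrite ler_pdivrMr// mul1r -natrX ler_nat => + kn; exact.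
apply/eqP; rewrite eq_le; apply/andP; split; apply/ler_addgt0Pr => e e0.
- have [m [j [jx xj je]]] := dyadic_approx x0 e0.
  have : pr (dyadic_chain m j.+1) <= j.+1%:R / 2 ^+ m.
    have [//|jm] := leP (j.+1%:R / 2 ^+ m : R) 1; first by move/pD ->.
    rewrite (le_trans _ (ltW jm))// -prT le_pr//.
    by have [] := dyadic_chainP m.
  move=> /(le_trans _) h; apply: le_trans (_ : j.+1%:R / 2 ^+ m <= _); last first.
    by rewrite (le_trans je)// lerD2r ltW.
  apply: h; apply: le_pr => //; first by have [] := dyadic_chainP m.
  move=> w /uniform_rv_lt[n [k [kx wk]]]; apply: dyadic_chain_sub wk.
  rewrite -(ler_nat R) !natrM !natrX -ler_pdivrMr// mulrAC -ler_pdivlMr//.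
  exact/ltW/(lt_le_trans kx).
- have [n [k [kx xk ke]]] := dyadic_approx x0 e0.
  apply: (le_trans (le_trans xk ke)).
  rewrite lerD2r -pD; last by rewrite ltW// (lt_le_trans kx).
  apply: le_pr => //; first by have [] := dyadic_chainP n.
  by move=> w wk; apply/uniform_rv_lt; exists n, k.
Qed.

End RealProbability.

(** * Laws and quantile functions *)

(** The half-lines []-oo, x]] are stable under intersection and generate the Borel sets, and those
    with integer ends exhaust the line with finite measure, so uniqueness of measures applies. *)
Lemma measure_eq_of_cdf (R : realType) (m1 m2 : {measure set R -> \bar R}) :
  (forall x, m1 `]-oo, x]%classic = m2 `]-oo, x]%classic) ->
  (forall x, m1 `]-oo, x]%classic < +oo)%E ->
  forall B, measurable B -> m1 B = m2 B.
Proof.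
move=> m12 fin.
pose G := [set A : set R | exists x : R, A = `]-oo, x]%classic].
apply: (measure_unique G (fun n => `]-oo, n%:R]%classic)).
- apply/seteqP; split => [A|].
    have -> : @measurable _ R = _ := RGenOInfty.measurableE R.
    apply: smallest_sub; first exact: smallest_sigma_algebra.
    move=> _ [x ->]; rewrite -setCitvl; apply: sigma_algebraC.
    by apply: sub_sigma_algebra; exists x.
  apply: smallest_sub; first exact: sigma_algebra_measurable.
  by move=> _ [x ->]; exact: measurable_itv.
- move=> _ _ [x ->] [y ->]; exists (Num.min x y).
  by apply/seteqP; split => z /=; rewrite !in_itv/= le_min => /andP.
- by move=> n; exists n%:R.
- rewrite -subTset => x _; exists (Num.trunc x).+1 => //=.
  by rewrite in_itv/= ltW// truncnS_gt.
- by move=> _ [x ->].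
- by move=> n; exact: fin.
Qed.

(** * The uniform law on the unit interval and the transfer of integrals between variables of equal
    law *)

Definition uniform01 (R : realType) : probability (measurableTypeR R) R :=
  uniform_prob (@ltr01 R).

Section Law.
Context (R : realType).
Local Notation mu := (@lebesgue_measure R).
Local Notation lam := (uniform01 R).

Lemma uniform_probE (A : set R) : measurable A -> lam A = mu (A `&` `[0, 1]).
Proof.
move=> mA; rewrite /uniform01 /= /uniform_prob integral_uniform_pdf.
under eq_integral.
  move=> x; rewrite inE/= in_itv/= => -[_ x01]; rewrite /uniform_pdf x01 subr0 invr1; over.
by rewrite integral_cst ?mul1e//; exact: measurableI.
Qed.

Lemma uniform01_cdf (x : R) : 0 <= x <= 1 -> lam `]-oo, x]%classic = x%:E.
Proof.
move=> /andP[x0 x1]; rewrite uniform_probE//.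
rewrite (_ : _ `&` _ = `[0, x]%classic); last first.
  apply/seteqP; split=> y /=; rewrite !in_itv/=; first by move=> [-> /andP[-> _]].
  by move=> /andP[-> yx]; rewrite yx (le_trans yx).
by rewrite lebesgue_measure_itv/= lte_fin sube0; case: ltgtP x0 => // <-.
Qed.

Lemma uniform_prob_ge1 (x : R) : 1 <= x -> lam `]-oo, x]%classic = 1%:E.
Proof.
move=> x1; rewrite uniform_probE//.
rewrite (_ : _ `&` _ = `[0, 1]%classic); last first.
  apply/seteqP; split=> y /=; rewrite !in_itv/=; first by case.
  by move=> /[dup]/andP[_ y1] ->; rewrite (le_trans y1).
by rewrite lebesgue_measure_itv/= lte_fin ltr01 sube0.
Qed.

Lemma uniform_prob_le0 (x : R) : x <= 0 -> lam `]-oo, x]%classic = 0%:E.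
Proof.
move=> x0; apply/eqP; rewrite eq_le measure_ge0 andbT -(@uniform01_cdf 0) ?lexx ?ler01//.
rewrite le_measure ?inE//; apply: subset_itvl; by rewrite bnd_simp.
Qed.

Lemma law_eq_of_cdf d1 d2 (T1 : measurableType d1) (T2 : measurableType d2)
  (P1 : probability T1 R) (P2 : probability T2 R) (X : T1 -> R) (Y : T2 -> R) :
  measurable_fun setT X -> measurable_fun setT Y ->
  (forall x, P1 [set t | X t <= x] = P2 [set t | Y t <= x]) ->
  forall B, measurable B -> P1 (X @^-1` B) = P2 (Y @^-1` B).
Proof.
move=> mX mY XY.
pose mX' := isMeasurableFun.Build _ _ _ _ X mX.
pose mY' := isMeasurableFun.Build _ _ _ _ Y mY.
pose X' : {mfun T1 >-> R} := HB.pack X mX'.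
pose Y' : {mfun T2 >-> R} := HB.pack Y mY'.
have e d (T : measurableType d) (Z : T -> R) x : Z @^-1` `]-oo, x] = [set t | Z t <= x].
  by apply/seteqP; split => t /=; rewrite in_itv.
apply: (@measure_eq_of_cdf R (pushforward P1 X') (pushforward P2 Y')) => x.
  by rewrite -[LHS]/(P1 (X @^-1` _)) -[RHS]/(P2 (Y @^-1` _)) !e.
rewrite -[X in (X < _)%E]/(P1 (X @^-1` _)) e.
exact/(le_lt_trans _ (ltry 1))/probability_le1/measurable_le_cst.
Qed.

(** Change of variables turns the integral of a nonnegative function into one against the common law
    on the line; positive and negative parts are treated separately. *)
Lemma integral_law_eq d1 d2 (T1 : measurableType d1) (T2 : measurableType d2)
  (P1 : probability T1 R) (P2 : probability T2 R) (X : T1 -> R) (Y : T2 -> R) :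
  measurable_fun setT X -> measurable_fun setT Y ->
  (forall B, measurable B -> P1 (X @^-1` B) = P2 (Y @^-1` B)) ->
  forall f : R -> R, measurable_fun setT f ->
  P1.-integrable setT (EFin \o (f \o X)) ->
  P2.-integrable setT (EFin \o (f \o Y)) /\
  (\int[P2]_t (f (Y t))%:E = \int[P1]_t (f (X t))%:E)%E.
Proof.
move=> mX mY XY f mf.
pose mX' := isMeasurableFun.Build _ _ _ _ X mX.
pose mY' := isMeasurableFun.Build _ _ _ _ Y mY.
pose X' : {mfun T1 >-> R} := HB.pack X mX'.
pose Y' : {mfun T2 >-> R} := HB.pack Y mY'.
have ge0 (g : R -> \bar R) : measurable_fun setT g -> (forall x, 0 <= g x)%E ->
   (\int[P2]_t (g (Y t)) = \int[P1]_t (g (X t)))%E.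
  move=> mg g0.
  have /= := @ge0_integral_pushforward _ _ _ _ R X' (measurable_funP X') P1
    setT g measurableT mg.
  rewrite preimage_setT => <- //.
  have /= := @ge0_integral_pushforward _ _ _ _ R Y' (measurable_funP Y') P2
    setT g measurableT mg.
  rewrite preimage_setT => <- //.
  by apply: eq_measure_integral => B mB _; exact/esym/XY.
have mf' : measurable_fun setT (EFin \o f) by exact/measurable_EFinP.
move=> /integrableP[_ iX]; split.
  apply/integrableP; split; first exact: (measurableT_comp mf' mY).
  rewrite (_ : \int[_]__ _ = \int[P1]_t `|(f (X t))%:E|)%E//.
  by apply: (ge0 (fun x => `|(f x)%:E|)%E) => //; exact: measurableT_comp.
suff : (\int[P2]_t ((EFin \o f) \o Y) t = \int[P1]_t ((EFin \o f) \o X) t)%E by [].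
rewrite integralE [RHS]integralE (funepos_comp (EFin \o f) X).
rewrite (funepos_comp (EFin \o f) Y) (funeneg_comp (EFin \o f) X).
rewrite (funeneg_comp (EFin \o f) Y).
by congr (_ - _)%E; apply: ge0 => //;
  [exact: measurable_funepos|exact: measurable_funeneg].
Qed.
Lemma integrable_uniform_prob (f : R -> R) : measurable_fun setT f ->
  lam.-integrable setT (EFin \o f) ->
  mu.-integrable `[0, 1] (EFin \o f) /\
  (\int[lam]_t (f t)%:E = \int[mu]_(t in `[0%R, 1%R]) (f t)%:E)%E.
Proof.
move=> mf.
have mf' : measurable_fun (setT : set (measurableTypeR R)) (EFin \o f) by exact/measurable_EFinP.
have ge0 (g : measurableTypeR R -> \bar R) : measurable_fun setT g -> (forall x, 0 <= g x)%E ->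
   (\int[lam]_t g t = \int[mu]_(t in `[0%R, 1%R]) g t)%E.
  by move=> mg g0; rewrite [LHS]integral_uniform// subr0 invr1 mul1e.
move=> /integrableP[_ iX]; split.
  apply/integrableP; split; first exact: measurable_funTS.
    rewrite -(ge0 (abse \o (EFin \o f)))//; last by move=> x; exact: abse_ge0.
  by apply: measurableT_comp => //; exact: abse_measurable.
rewrite integralE [RHS]integralE; congr (_ - _)%E.
  by apply: (ge0 ((EFin \o f)^\+)%E) => //; exact: measurable_funepos.
by apply: (ge0 ((EFin \o f)^\-)%E) => //; exact: measurable_funeneg.
Qed.

(** The endpoints are null. Restricting to []0, 1[] removes the arguments at which [quantile] takes
    its junk value. *)
Lemma uniform_prob_setI01 (A : set R) : measurable A -> lam A = lam (A `&` `]0, 1[).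
Proof.
move=> mA.
have l1 : pr lam `]0, 1[%classic = 1.
  rewrite /pr uniform_probE// setIidl; last exact: subset_itv_oo_cc.
  by rewrite lebesgue_measure_itv/= lte_fin ltr01 sube0.
have mD : measurable (A `\` `]0, 1[) by exact: measurableD.
rewrite prE// prE; last exact: measurableI.
congr (_%:E); rewrite -{1}(setUIDK A `]0, 1[) prU//.
- have h : pr lam (setT `\` `]0, 1[%classic) = 0 by rewrite prD// prT l1 subrr.
  rewrite -[RHS]addr0; congr (_ + _); apply/eqP; rewrite eq_le pr_ge0 andbT.
  rewrite -[leRHS]h; apply: le_pr => //; first exact: measurableD.
  by move=> x [_ ?]; split.
- exact: measurableI.
- by rewrite setDE setIACA setICr setI0.
Qed.

End Law.

(** * The quantile function of a random variable and its law *)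

Section Quantile.
Context {d : measure_display} {T : measurableType d} {R : realType}
  (P : probability T R) (X : T -> R).
Hypothesis mX : measurable_fun setT X.
Local Notation mu := (@lebesgue_measure R).
Local Notation lam := (uniform01 R).

Definition Cdf (x : R) : R := pr P [set t | X t <= x].

(* VaR is infinite, or possibly infinite, outside ]0, 1[, hence the junk value. *)
Definition quantile (u : R) : R :=
  if 0 < u < 1 then fine (VaR P u X) else 0.

Let mle x := measurable_le_cst x mX.

Lemma cdfE x : Defs.cdf P X x = (Cdf x)%:E. Proof. exact: prE. Qed.

Lemma Cdf_le x y : x <= y -> Cdf x <= Cdf y.
Proof. by move=> xy; apply: le_pr => // t /= /le_trans; exact. Qed.

Lemma Cdf01 x : 0 <= Cdf x <= 1.
Proof. by rewrite pr_ge0 -(prT P) le_pr. Qed.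

Let prC (A : set T) : measurable A -> pr P (~` A) = 1 - pr P A.
Proof. by move=> mA; rewrite -setTD prD// prT. Qed.

(** Right continuity, seen on complements: [{X > x}] is the increasing union of the events
    [{X > x + 1 / n.+1}]. *)
Lemma Cdf_right_cont x u : (forall y, x < y -> u <= Cdf y) -> u <= Cdf x.
Proof.
move=> h; suff : pr P (~` [set t | X t <= x]) <= 1 - u by rewrite prC// /Cdf; lra.
rewrite (_ : ~` _ = \bigcup_n ~` [set t | X t <= x + n.+1%:R^-1]).
  apply: pr_bigcup_le => [n|m n mn|n]; first exact: measurableC.
    apply/subsetPset/subsetC => t /= /le_trans; apply.
    by rewrite lerD2l lef_pV2 ?posrE// ler_nat.
  by rewrite prC// lerD2l lerN2 h// ltrDl invr_gt0.
apply/seteqP; split => t /=; last first.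
  move=> [n _ /=] /negP; rewrite -ltNge => tn.
  by apply/negP; rewrite -ltNge (le_lt_trans _ tn)// lerDl invr_ge0.
move=> /negP; rewrite -ltNge => xt; have e0 : 0 < X t - x by rewrite subr_gt0.
have [n _ /(_ n (leqnn n)) ne] := near_infty_natSinv_lt (PosNum e0).
by exists n => //=; apply/negP; rewrite -ltNge -ltrBrDl.
Qed.

Lemma Cdf_ge_ex u : u < 1 -> exists x, u <= Cdf x.
Proof.
move=> u1; apply: contrapT => /forallNP h; suff : 1 <= u by lra.
rewrite -(prT P) (_ : setT = \bigcup_n [set t | X t <= n%:R]).
  apply: pr_bigcup_le => // [m n mn|n].
    by apply/subsetPset => t /= /le_trans; apply; rewrite ler_nat.
  by have /negP := h n%:R; rewrite -ltNge => /ltW.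
apply/esym; rewrite -subTset => t _; exists (Num.trunc (X t)).+1 => //=.
by rewrite ltW// truncnS_gt.
Qed.

Lemma Cdf_lt_ex u : 0 < u -> exists x, Cdf x < u.
Proof.
move=> u0; apply: contrapT => /forallNP h; suff : 1 <= 1 - u by lra.
rewrite -[leLHS](prT P) (_ : setT = \bigcup_n ~` [set t | X t <= - n%:R]).
  apply: pr_bigcup_le => [n|m n mn|n]; first exact: measurableC.
    apply/subsetPset/subsetC => t /= /le_trans; apply.
    by rewrite lerN2 ler_nat.
  by rewrite prC// lerD2l lerN2; have /negP := h (- n%:R); rewrite -leNgt.
apply/esym; rewrite -subTset => t _; exists (Num.trunc (- X t)).+1 => //=.
by apply/negP; rewrite -ltNge ltrNl truncnS_gt.
Qed.

(** The Galois connection between quantiles and distribution function. Right continuity of [Cdf]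
    yields the implication from left to right, since it puts the infimum itself in the set. *)
Lemma VaR_le u x : 0 < u -> (VaR P u X <= x%:E)%E <-> u <= Cdf x.
Proof.
move=> u0; split=> [ux|ux]; last first.
  by apply: ereal_inf_lbound; exists x => //=; rewrite cdfE lee_fin.
apply: Cdf_right_cont => y xy.
have /ereal_inf_lt[_ [z /= uz <-]] : (VaR P u X < y%:E)%E.
  by rewrite (le_lt_trans ux)// lte_fin.
by rewrite lte_fin => /ltW zy; move: uz; rewrite cdfE lee_fin => /le_trans; apply; exact: Cdf_le.
Qed.

Lemma VaR_quantile u : 0 < u < 1 -> VaR P u X = (quantile u)%:E.
Proof.
move=> u01; rewrite /quantile u01 fineK//.
move: u01 => /andP[u0 u1]; rewrite fin_numE; apply/andP; split.
  apply/eqP => Vy; have [x] := Cdf_lt_ex u0.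
  by rewrite ltNge => /negP; apply; apply/VaR_le => //; rewrite Vy leNye.
apply/eqP => Vy; have [x] := Cdf_ge_ex u1.
by move=> /(VaR_le x u0); rewrite Vy.
Qed.

Lemma quantile_le u x : 0 < u < 1 -> (quantile u <= x) = (u <= Cdf x).
Proof.
move=> u01; rewrite -lee_fin -VaR_quantile//; have /andP[u0 _] := u01.
by apply/idP/idP => /VaR_le; exact.
Qed.

Lemma quantile_mono u v : 0 < u -> u <= v -> v < 1 -> quantile u <= quantile v.
Proof.
move=> u0 uv v1; rewrite quantile_le ?u0 ?(le_lt_trans uv)//.
by apply: (le_trans uv); rewrite -quantile_le ?v1 ?andbT// (lt_le_trans u0).
Qed.

Lemma measurable_quantile : measurable_fun setT quantile.
Proof.
apply: (measurability _ (RGenOInfty.measurableE R)) => _ [_ [x ->] <-].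
(* Outside []0, 1[] the function is 0, which exceeds [x] exactly when [x < 0]. *)
rewrite setTI (_ : _ @^-1` _ = (`]0, 1[ `&` `]Cdf x, +oo[) `|`
    (if x < 0 then ~` `]0, 1[ else set0)).
  apply: measurableU; first exact: measurableI.
  by case: ifP => // _; exact: measurableC.
apply/seteqP; split => u /=; rewrite !in_itv/= !andbT.
  move=> xu; have [u01|u01] := boolP (0 < u < 1).
    by left; split=> //; rewrite ltNge -quantile_le// -ltNge.
  by right; move: xu; rewrite /quantile (negbTE u01) => ->; rewrite /= in_itv/=; exact/negP.
move=> [[u01]|]; first by rewrite !ltNge quantile_le.
by case: ifPn => //= x0; rewrite in_itv/= /quantile => /negP/negbTE ->.
Qed.

(** On []0, 1[], [quantile u <= x] means [u <= Cdf x], an event of uniform measure [Cdf x]; so the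
    two distribution functions agree. *)
Lemma quantile_law B : measurable B -> lam (quantile @^-1` B) = P (X @^-1` B).
Proof.
apply: (@law_eq_of_cdf R _ _ (measurableTypeR R) T) => // [|x]; first exact: measurable_quantile.
have /andP[F0 F1] := Cdf01 x.
rewrite [RHS]prE// -/(Cdf x) -uniform01_cdf ?F0//.
rewrite uniform_prob_setI01; last first.
  exact: (@measurable_le_cst _ (measurableTypeR R) R _ x measurable_quantile).
rewrite [RHS]uniform_prob_setI01//; congr (lam _).
apply/seteqP; split => u /=; rewrite !in_itv/= => -[h u01]; split => //.
  by rewrite -quantile_le.
by rewrite quantile_le.
Qed.

(** [V] under [P] has the law of the identity under [lam], which reduces the claim to
    [quantile_law]. *)
Lemma quantile_comp_law (V : T -> R) : measurable_fun setT V ->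
  (forall y, 0 <= y <= 1 -> pr P [set t | V t <= y] = y) ->
  same_law P (quantile \o V) X.
Proof.
move=> mV hV B mB; rewrite -quantile_law//= comp_preimage.
have mQB : measurable (quantile @^-1` B).
  by rewrite -[X in measurable X]setTI; exact: measurable_quantile.
have mleV y := measurable_le_cst y mV.
apply: (@law_eq_of_cdf R _ _ T (measurableTypeR R) P lam V id) => // x.
rewrite prE//; rewrite (_ : [set t : R | t <= x] = `]-oo, x]%classic); last first.
  by apply/seteqP; split => t /=; rewrite in_itv.
have [x0|x0] := leP x 0.
  rewrite uniform_prob_le0//; congr (_%:E); apply/eqP; rewrite eq_le pr_ge0 andbT.
  rewrite -[leRHS](hV 0) ?lexx ?ler01//; apply: le_pr => // t /= /le_trans; exact.
have [x1|x1] := leP x 1; first by rewrite uniform01_cdf ?hV// (ltW x0).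
rewrite uniform_prob_ge1 ?ltW//; congr (_%:E); apply/eqP; rewrite eq_le -{1}(prT P) le_pr//=.
rewrite -[leLHS](hV 1) ?lexx ?ler01//; apply: le_pr => // t /= /le_trans; apply; exact: ltW.
Qed.

Lemma integrable_quantile (f : R -> R) : measurable_fun setT f ->
  P.-integrable setT (EFin \o (f \o X)) ->
  mu.-integrable `[0, 1] (EFin \o (f \o quantile)) /\
  (\int[P]_t (f (X t))%:E = \int[mu]_(u in `[0%R, 1%R]) (f (quantile u))%:E)%E.
Proof.
move=> mf iX.
have [i1 e1] := @integral_law_eq R _ _ T (measurableTypeR R) P lam X quantile
  mX measurable_quantile (fun B mB => esym (quantile_law mB)) f mf iX.
have [i2 e2] :=
  integrable_uniform_prob (measurableT_comp mf measurable_quantile) i1.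
by split => //; rewrite -e1 e2.
Qed.

End Quantile.

(** * Expected shortfall *)

Section IntervalIntegrals.
Context (R : realType) (f : R -> R) (a b : R).
Local Notation mu := (@lebesgue_measure R).
Hypothesis f_int : mu.-integrable `]a, b[ (EFin \o f).

Lemma integrable_subitv c e : a <= c -> e <= b ->
  mu.-integrable `]c, e[ (EFin \o f).
Proof.
move=> ac eb; apply: integrableS f_int => //.
by apply: subset_itv; rewrite bnd_simp.
Qed.

Lemma Rintegral_itv_split c e : a <= c -> c <= e -> e < b ->
  \int[mu]_(u in `]c, b[) f u = \int[mu]_(u in `]c, e[) f u + \int[mu]_(u in `]e, b[) f u.
Proof.
move=> ac ce eb.
rewrite -(@Rintegral_itvB _ f (BRight c) (BLeft b) e) ?bnd_simp//; last first.
  exact: integrable_subitv.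
rewrite -Rintegral_itv_bndo_bndc; first by rewrite addrC subrK.
exact/integrable_subitv/ltW.
Qed.

Lemma Rintegral_itv_cst (k c e : R) : c <= e ->
  \int[mu]_(u in `]c, e[) (fun=> k) u = k * (e - c).
Proof.
move=> ce; rewrite Rintegral_cst//= lebesgue_measure_itv/= lte_fin.
by case: ltgtP ce => // -> _; rewrite subrr.
Qed.

Lemma integrable_itv_cst (k c e : R) :
  mu.-integrable `]c, e[ (EFin \o (fun=> k)).
Proof.
apply/integrableP; split; first exact: measurable_cst.
rewrite integral_cst//= lebesgue_measure_itv/=.
by case: ifP => _; rewrite ?mule0 ?ltry// -EFinB -EFinM ltry.
Qed.

Lemma Rintegral_itv_ge k c e : a <= c -> c <= e -> e <= b ->
  (forall u, c < u < e -> k <= f u) -> k * (e - c) <= \int[mu]_(u in `]c, e[) f u.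
Proof.
move=> ac ce eb kf; rewrite -Rintegral_itv_cst//.
apply: le_Rintegral; [by []|exact: integrable_itv_cst|exact: integrable_subitv|].
by move=> u; rewrite /= in_itv/=; exact: kf.
Qed.

Lemma Rintegral_itv_le k c e : a <= c -> c <= e -> e <= b ->
  (forall u, c < u < e -> f u <= k) -> \int[mu]_(u in `]c, e[) f u <= k * (e - c).
Proof.
move=> ac ce eb kf; rewrite -Rintegral_itv_cst//.
apply: le_Rintegral; [by []|exact: integrable_subitv|exact: integrable_itv_cst|].
by move=> u; rewrite /= in_itv/=; exact: kf.
Qed.

End IntervalIntegrals.

(** Inequalities between infinite-valued suprema and infima are refuted below at a real number lying
    strictly between the two sides. *)
Lemma ereal_between (R : realType) (x y : \bar R) : (x < y)%E ->
  exists z : R, (x < z%:E < y)%E.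
Proof.
case: x y => [r| |] [s| |]//=; rewrite ?lte_fin.
- by move=> rs; exists ((r + s) / 2); rewrite !lte_fin !midf_lt.
- by move=> _; exists (r + 1); rewrite lte_fin ltrDl ltr01 ltry.
- by move=> _; exists (s - 1); rewrite lte_fin ltrBlDr ltrDl ltr01 ltNyr.
- by move=> _; exists 0; rewrite ltNyr ltry.
Qed.

(** * Real-valued expected shortfall and monotonicity in the level *)

Section ExpectedShortfall.
Context {d : measure_display} {T : measurableType d} {R : realType}
  (P : probability T R).
Implicit Types X Y : T -> R.
Local Notation mu := (@lebesgue_measure R).

Lemma L1_measurable X : L1 P X -> measurable_fun setT X.
Proof. by move=> /(measurable_int P)/measurable_EFinP. Qed.

Lemma Rintegral_quantile X (f : R -> R) : measurable_fun setT f ->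
  measurable_fun setT X -> L1 P (f \o X) ->
  mu.-integrable `]0, 1[ (EFin \o (f \o quantile P X)) /\
  \int[mu]_(u in `]0, 1[) f (quantile P X u) = \int[P]_t f (X t).
Proof.
move=> mf mX iX; have [iq e] := integrable_quantile mX mf iX.
have iq' : mu.-integrable `]0, 1[ (EFin \o (f \o quantile P X)).
  by apply: integrableS iq => //; exact: subset_itv_oo_cc.
split=> //; rewrite Rintegral_itv_obnd_cbnd//.
rewrite Rintegral_itv_bndo_bndc; first by rewrite /Rintegral e.
by apply: integrableS iq => //; apply: subset_itv; rewrite bnd_simp.
Qed.

Lemma quantile_integrable X : L1 P X ->
  mu.-integrable `]0, 1[ (EFin \o quantile P X).
Proof.
move=> iX; have [] // := @Rintegral_quantile X id _ (L1_measurable iX) iX.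
Qed.

Definition es (a : R) X : R :=
  (1 - a)^-1 * \int[mu]_(u in `]a, 1[) quantile P X u.

Lemma ES_es a X : 0 <= a < 1 -> L1 P X -> ES P a X = (es a X)%:E.
Proof.
move=> /andP[a0 a1] iX; rewrite /ES a1 /es EFinM; congr (_ * _)%E.
have iq := quantile_integrable iX.
rewrite /Rintegral fineK; last first.
  by apply: integrable_fin_num => //; apply: (integrable_subitv iq).
apply: eq_integral => u; rewrite inE/= in_itv/= => /andP[au u1].
by rewrite (VaR_quantile P (L1_measurable iX)) ?u1 ?andbT ?(le_lt_trans a0).
Qed.

Lemma es_ge a X c : 0 <= a < 1 -> L1 P X ->
  (forall u, a < u < 1 -> c <= quantile P X u) -> c <= es a X.
Proof.
move=> /andP[a0 a1] iX cq; have a1' : 0 < 1 - a by lra.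
rewrite /es mulrC ler_pdivlMr//.
exact: (Rintegral_itv_ge (quantile_integrable iX) a0 (ltW a1)).
Qed.

Lemma es_le a X c : 0 <= a < 1 -> L1 P X ->
  (forall u, a < u < 1 -> quantile P X u <= c) -> es a X <= c.
Proof.
move=> /andP[a0 a1] iX cq; have a1' : 0 < 1 - a by lra.
rewrite /es mulrC ler_pdivrMr//.
exact: (Rintegral_itv_le (quantile_integrable iX) a0 (ltW a1)).
Qed.

(** [es a X] is a weighted mean of [es b X] and of the average of the quantile function over []a,
    b[], which is at most [quantile P X b], hence at most [es b X]. *)
Lemma es_mono a b X : 0 <= a -> a <= b -> b < 1 -> L1 P X -> es a X <= es b X.
Proof.
move=> a0 ab b1 iX; have iq := quantile_integrable iX.
have a1 : a < 1 by exact: le_lt_trans b1.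
(* Setting [a = b] aside gives [b > 0], so that [quantile P X b] is not the junk value. *)
have [->//|ab'] := eqVneq a b.
have b0 : 0 < b by rewrite (le_lt_trans a0)// lt_neqAle ab'.
have qb : quantile P X b <= es b X.
  apply: es_ge => //; first by rewrite (ltW b0).
  by move=> u /andP[bu u1]; apply: quantile_mono (ltW bu) u1; first exact: L1_measurable.
have a1' : 0 < 1 - a by lra. have b1' : 0 < 1 - b by lra.
rewrite {1}/es mulrC ler_pdivrMr// (Rintegral_itv_split iq a0 ab b1).
have -> : \int[mu]_(u in `]b, 1[) quantile P X u = (1 - b) * es b X.
  by rewrite /es mulrA divff ?mul1r// gt_eqF.
have : \int[mu]_(u in `]a, b[) quantile P X u <= es b X * (b - a).
  apply: (Rintegral_itv_le iq a0 ab (ltW b1)) => u /andP[au ub].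
  apply: le_trans qb; apply: quantile_mono => //; first exact: L1_measurable.
  - exact: le_lt_trans au.
  - exact: ltW.
by nra.
Qed.

(** At level 1 the right side is an infimum over the [x] with [P(X <= x) >= 1], and each such [x]
    bounds every quantile. *)
Lemma ES_mono a b X : 0 <= a -> a <= b -> b <= 1 -> L1 P X ->
  (ES P a X <= ES P b X)%E.
Proof.
move=> a0 ab; rewrite le_eqVlt => /predU1P[b1|b1] iX; last first.
  rewrite !ES_es ?(le_trans a0) ?(le_lt_trans ab) ?a0//.
  by rewrite lee_fin es_mono.
subst b; move: ab; rewrite le_eqVlt => /predU1P[->//|a1].
rewrite ES_es ?a0// {1}/ES ltxx.
apply: le_ereal_inf_tmp => _ [x /= cx <-]; rewrite lee_fin.
have mX := L1_measurable iX.
apply: es_le => //; first by rewrite a0.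
move=> u /andP[au u1]; have u0 : 0 < u by exact: le_lt_trans au.
rewrite quantile_le ?u0//; apply: (le_trans (ltW u1)).
by rewrite -lee_fin -cdfE.
Qed.

(** * Excess integrals and convexity of expected shortfall *)

Definition excess (x t : R) : R := Num.max (t - x) 0.

Lemma measurable_excess x : measurable_fun setT (excess x).
Proof. by apply: measurable_maxr => //; exact: measurable_funB. Qed.

Lemma L1_cst c : L1 P (cst c).
Proof. exact: finite_measure_integrable_cst. Qed.

Lemma L1_comb X Y a b : L1 P X -> L1 P Y -> L1 P (fun t => a * X t + b * Y t).
Proof.
move=> iX iY.
have := integrableD measurableT (integrableZl measurableT a iX) (integrableZl measurableT b iY).
by apply: eq_integrable.
Qed.

Lemma L1_excess X x : L1 P X -> L1 P (excess x \o X).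
Proof.
move=> iX; have mX := L1_measurable iX.
have i2 := integrableD measurableT (integrable_abse iX) (integrable_abse (L1_cst x)).
apply: le_integrable i2 => //.
  by apply/measurable_EFinP; apply: measurableT_comp => //; exact: measurable_excess.
move=> t _ /=; rewrite lee_fin [leRHS]ger0_norm ?addr_ge0//.
rewrite /excess; have := ler_normB (X t) x; have := ler_norm (X t - x).
by case: (leP (X t - x) 0) => _; rewrite ?normr0 ?addr_ge0.
Qed.

(* The two halves of the Rockafellar-Uryasev formula, multiplied by 1 - a. *)
Lemma es_excess_le a x X : 0 <= a < 1 -> L1 P X ->
  (1 - a) * es a X <= (1 - a) * x + \int[P]_t excess x (X t).
Proof.
move=> /andP[a0 a1] iX; have a1' : 0 < 1 - a by lra.
have mX := L1_measurable iX.
have iq := quantile_integrable iX.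
have [ie <-] := Rintegral_quantile (measurable_excess x) mX (L1_excess x iX).
rewrite /es mulrA divff ?gt_eqF// mul1r.
(* The integrand satisfies [q <= x + excess x q]; extending the excess integral from []a, 1[] to
   []0, 1[] afterwards only increases it. *)
apply: (@le_trans _ _ (\int[mu]_(u in `]a, 1[) (x + excess x (quantile P X u)))).
  apply: le_Rintegral => //.
  - exact: (integrable_subitv iq).
  - apply: (@integrableD _ _ _ mu `]a, 1[%classic (measurable_itv _) (EFin \o (fun=> x))
      (EFin \o (excess x \o quantile P X))) => //.
      exact: integrable_itv_cst.
    exact: (integrable_subitv ie).
  - by move=> u _; rewrite -lerBlDl /excess le_max lexx.
rewrite RintegralD//; [|exact: integrable_itv_cst|exact: (integrable_subitv ie)].
rewrite (Rintegral_itv_cst x (ltW a1)) mulrC lerD2l.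
have [->//|a0'] := eqVneq a 0.
rewrite (Rintegral_itv_split ie (lexx 0) a0 a1) lerDr.
by apply: Rintegral_ge0 => u _; rewrite /excess le_max lexx orbT.
Qed.

Lemma es_excess_eq a X : 0 < a < 1 -> L1 P X ->
  (1 - a) * es a X =
  (1 - a) * quantile P X a + \int[P]_t excess (quantile P X a) (X t).
Proof.
move=> /andP[a0 a1] iX; have a1' : 0 < 1 - a by lra.
have mX := L1_measurable iX; set x := quantile P X a.
have iq := quantile_integrable iX.
have [ie <-] := Rintegral_quantile (measurable_excess x) mX (L1_excess x iX).
rewrite /es mulrA divff ?gt_eqF// mul1r.
rewrite (Rintegral_itv_split ie (lexx 0) (ltW a0) a1).
(* For [x = q(a)], monotonicity makes the excess vanish on []0, a[] and equal [q - x] on []a,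
   1[]. *)
rewrite (_ : \int[mu]_(u in `]0, a[) _ = 0) ?add0r; last first.
  rewrite (@eq_Rintegral _ _ _ _ _ (fun=> 0)); last first.
    move=> u; rewrite inE/= in_itv/= => /andP[u0 ua].
    by rewrite /excess; apply/max_idPr; rewrite subr_le0 quantile_mono// ltW.
  by rewrite (Rintegral_itv_cst 0 (ltW a0)) mul0r.
rewrite [RHS](_ : _ = (1 - a) * x + \int[mu]_(u in `]a, 1[) (quantile P X u - x)); last first.
  congr (_ + _); apply: eq_Rintegral.
  move=> u; rewrite inE/= in_itv/= => /andP[au u1].
  by rewrite /excess; apply/max_idPl; rewrite subr_ge0 quantile_mono// ltW.
rewrite RintegralB//; [|exact: (integrable_subitv iq (ltW a0))|exact: integrable_itv_cst].
by rewrite (Rintegral_itv_cst x (ltW a1)); ring.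
Qed.

Lemma Rintegral_comb X Y a b : L1 P X -> L1 P Y ->
  \int[P]_t (a * X t + b * Y t) = a * \int[P]_t X t + b * \int[P]_t Y t.
Proof.
move=> iX iY; rewrite RintegralD//; first by rewrite !RintegralZl.
- exact: integrableZl iX.
- exact: integrableZl iY.
Qed.

(** For [a > 0], the upper bound for the combination is evaluated at the same combination of the
    minimisers [x] and [y] of [X] and [Y]; joint convexity of the excess concludes. *)
Lemma es_convex a X Y g : 0 <= a < 1 -> L1 P X -> L1 P Y -> 0 <= g <= 1 ->
  es a (fun t => g * X t + (1 - g) * Y t) <= g * es a X + (1 - g) * es a Y.
Proof.
move=> /andP[a0 a1] iX iY /andP[g0 g1]; set Z := fun t => _.
have iZ : L1 P Z by exact: L1_comb.
(* At level 0 the quantile is junk and cannot serve as minimiser, but [es 0] is the expectation,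
   which is linear. *)
have [a00|a0'] := eqVneq a 0.
  have es0 W : L1 P W -> es a W = \int[P]_t W t.
    move=> iW; rewrite a00 /es subr0 invr1 mul1r.
    by have [] := @Rintegral_quantile W id _ (L1_measurable iW) iW.
  by rewrite !es0// Rintegral_comb.
have a0'' : 0 < a < 1 by rewrite lt_neqAle eq_sym a0' a0.
have a1' : 0 < 1 - a by lra.
rewrite -(ler_pM2l a1').
have eX := es_excess_eq a0'' iX; have eY := es_excess_eq a0'' iY.
set x := quantile P X a in eX; set y := quantile P Y a in eY.
have a01 : 0 <= a < 1 by rewrite a0.
apply: (le_trans (es_excess_le (g * x + (1 - g) * y) a01 iZ)).
have : \int[P]_t excess (g * x + (1 - g) * y) (Z t) <=
  \int[P]_t (g * excess x (X t) + (1 - g) * excess y (Y t)).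
  apply: le_Rintegral => //.
  - exact: L1_excess.
  - by apply: L1_comb; exact: L1_excess.
  move=> t _; rewrite {1}/excess ge_max; apply/andP; split.
    have : X t - x <= excess x (X t) by rewrite le_max lexx.
    have : Y t - y <= excess y (Y t) by rewrite le_max lexx.
    by rewrite /Z; nra.
  have : 0 <= excess x (X t) by rewrite le_max lexx orbT.
  have : 0 <= excess y (Y t) by rewrite le_max lexx orbT.
  by nra.
rewrite (Rintegral_comb g (1 - g) (L1_excess x iX) (L1_excess y iY)).
by nra.
Qed.

(** [VaR] at level 1 is the essential supremum: if it is below [z] for both [X] and [Y], then almost
    surely both are at most [z], and so is their combination. *)
Lemma VaR1_quasi_convex X Y g : measurable_fun setT X -> measurable_fun setT Y ->
  0 <= g <= 1 ->
  (VaR P 1 (fun t => g * X t + (1 - g) * Y t)%R <= maxe (VaR P 1 X) (VaR P 1 Y))%E.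
Proof.
move=> mX mY /andP[g0 g1].
have key W z : measurable_fun setT W -> (VaR P 1 W < z%:E)%E ->
    pr P [set t | W t <= z] = 1.
  move=> mW /ereal_inf_lt[_ [y /= cy <-]]; rewrite lte_fin => yz.
  have mle v := measurable_le_cst v mW.
  apply/eqP; rewrite eq_le -{1}(prT P) le_pr//=.
  apply: (@le_trans _ _ (Cdf P W y)); first by rewrite -lee_fin -cdfE.
  by apply: le_pr => // t /= /le_trans; apply; exact: ltW.
rewrite leNgt; apply/negP => /ereal_between[z /andP[+ zZ]].
rewrite gt_max => /andP[Xz Yz]; move: zZ; rewrite ltNge => /negP; apply.
apply: ereal_inf_lbound; exists z => //=.
have mZ : measurable_fun setT (fun t => g * X t + (1 - g) * Y t).
  by apply: measurable_funD; exact: measurable_funM.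
pose A := [set t | X t <= z]; pose B := [set t | Y t <= z].
have mA : measurable A by exact: measurable_le_cst.
have mB : measurable B by exact: measurable_le_cst.
have AB : pr P (A `&` B) = 1.
  have B0 : pr P (setT `\` B) = 0 by rewrite prD// prT (key Y)// subrr.
  have : pr P (A `\` B) <= 0.
    by rewrite -B0; apply: le_pr => [||t [_ ?]]; [exact: measurableD..|split].
  have := pr_ge0 P (A `\` B).
  have : pr P (A `&` B) + pr P (A `\` B) = 1.
    rewrite -prU ?setUIDK ?(key X)//.
    - exact: measurableI.
    - exact: measurableD.
    - by rewrite setDE setIACA setICr setI0.
  by lra.
rewrite (cdfE P mZ) lee_fin -[leLHS]AB; apply: le_pr.
- exact: measurableI.
- exact: (measurable_le_cst z mZ).
- by move=> t []; rewrite /A /B /= => Xt Yt; nra.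
Qed.

Lemma ES_quasi_convex a X Y g : 0 <= a <= 1 -> L1 P X -> L1 P Y -> 0 <= g <= 1 ->
  (ES P a (fun t => g * X t + (1 - g) * Y t)%R <= maxe (ES P a X) (ES P a Y))%E.
Proof.
move=> /andP[a0]; rewrite le_eqVlt => /predU1P[->|a1] iX iY g01.
  by rewrite /ES ltxx; apply: VaR1_quasi_convex => //; exact: L1_measurable.
have a01 : 0 <= a < 1 by rewrite a0.
rewrite !ES_es//; last exact: L1_comb.
rewrite -EFin_max lee_fin (le_trans (es_convex a01 iX iY g01))//.
move: g01 => /andP[g0 g1]; rewrite le_max.
by have [|] := leP (es a X) (es a Y) => h; apply/orP; [right|left]; nra.
Qed.

End ExpectedShortfall.

(** * Rearrangements *)

(** Translation by [e] modulo [1 - a] on [[a, 1[], seen as a circle, and the identity below [a]. *)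
Definition rotation {R : realType} (a e u : R) : R :=
  if u < a then u else if u < 1 - e then u + e else u + e - (1 - a).

(** The first term collects the points below [a] and those shifted without wrapping; the second
    collects the points of [[1 - e, 1[], which wrap. *)
Lemma rotation_lt {R : realType} (a e u y : R) : 0 <= e < 1 - a ->
  a < y <= 1 -> (rotation a e u < y) =
  (u < Num.max a (y - e)) || ((u < y - e + (1 - a)) && (1 - e <= u)).
Proof.
move=> /andP[e0 ea] /andP[ay y1]; rewrite /rotation lt_max.
have [ua|ua] /= := ltP u a; first by rewrite (lt_trans ua ay).
have [ue|ue] := ltP u (1 - e); first by rewrite andbF orbF ltrBrDr.
rewrite andbT (_ : u < y - e = false); last by apply/negbTE; rewrite -leNgt; lra.
by apply/idP/idP; lra.
Qed.

Lemma measurable_rotation {R : realType} (a e : R) : measurable_fun setT (rotation a e).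
Proof.
apply: measurable_fun_ifT; [exact: measurable_fun_ltr|by []|].
apply: measurable_fun_ifT; [exact: measurable_fun_ltr|exact: measurable_funD|].
by apply: measurable_funB => //; exact: measurable_funD.
Qed.

(** On the cell from [a + (j - 1) h] to [a + j h], the monotone [q] is at most its value at
    [v + j h], because [a <= v]. The sum starts at 1: the point [v] itself matches no cell. *)
Lemma riemann_lower {R : realType} (q : R -> R) (a b h v : R) (m : nat) :
  0 < h -> a <= v -> a + m%:R * h <= b ->
  (@lebesgue_measure R).-integrable `]a, b[ (EFin \o q) ->
  (forall x y, a < x -> x <= y -> y <= v + m%:R * h -> q x <= q y) ->
  \int[@lebesgue_measure R]_(u in `]a, a + m%:R * h[) q u <=
  h * \sum_(1 <= j < m.+1) q (v + j%:R * h).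
Proof.
move=> h0 av + iq; elim: m => [|m IH] mb qmono.
  by rewrite mul0r addr0 set_itvoo0 Rintegral_set0 big_geq// mulr0.
have mS : m.+1%:R * h = m%:R * h + h by rewrite -natr1 mulrDl mul1r.
have mh : 0 <= m%:R * h by rewrite mulr_ge0// ltW.
have iq' : (@lebesgue_measure R).-integrable `]a, a + m.+1%:R * h[ (EFin \o q).
  by apply: (integrable_subitv iq).
rewrite (Rintegral_itv_split iq' (lexx a) (e := a + m%:R * h)) ?lerDl//; last by lra.
rewrite big_nat_recr//= mulrDr; apply: lerD.
  by apply: IH => [|x y ax xy yv]; [|apply: qmono => //]; lra.
have -> : h * q (v + m.+1%:R * h) = q (v + m.+1%:R * h) * (a + m.+1%:R * h - (a + m%:R * h)).
  by rewrite mulrC mS; congr (_ * _); ring.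
apply: (Rintegral_itv_le iq) => //; [lra..|].
by move=> u /andP[au ub]; apply: qmono => //; lra.
Qed.

(** Write [u = v + i h] with [v] in the first cell. Rotations by multiples of [h] permute the points
    [v + j h] cyclically. *)
Lemma sum_rotation {R : realType} (q : R -> R) (a u h : R) (n : nat) :
  0 < h -> n%:R * h = 1 - a -> a <= u < 1 ->
  exists2 v, a <= v < a + h &
  \sum_(0 <= k < n) q (rotation a (k%:R * h) u) = \sum_(0 <= j < n) q (v + j%:R * h).
Proof.
move=> h0 nh /andP[au u1].
have ua0 : 0 <= (u - a) / h by rewrite divr_ge0 ?subr_ge0// ltW.
pose i := Num.trunc ((u - a) / h).
have i1 : i%:R * h <= u - a by rewrite -ler_pdivlMr// truncn_le.
have i2 : u - a < i.+1%:R * h by rewrite -ltr_pdivrMr// truncnS_gt.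
have iS : i.+1%:R * h = i%:R * h + h by rewrite -natr1 mulrDl mul1r.
have ilen : (i < n)%N.
  by rewrite -(ltr_nat R) -(ltr_pM2r h0) nh; lra.
exists (u - i%:R * h); first by apply/andP; split; lra.
have ni : (n - i <= n)%N by rewrite leq_subr.
(* The rotations with [k < n - i] do not wrap and reach the indices from [i] on; the others wrap and
   reach the indices below [i]. *)
rewrite (big_cat_nat _ (n := n - i))//= [RHS](big_cat_nat _ (n := i))//=; last exact: ltnW.
rewrite addrC; congr (_ + _).
  rewrite -{1}(add0n (n - i)%N) big_addn subKn; last exact: ltnW.
  apply: eq_big_nat => j /andP[_ ji]; congr q.
  have jn : (j + (n - i))%:R = j%:R + n%:R - i%:R :> R by rewrite natrD natrB ?addrA// ltnW.
  have ji' : j.+1%:R * h <= i%:R * h by rewrite ler_pM2r// ler_nat.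
  have j0 : 0 <= j%:R * h by rewrite mulr_ge0// ltW.
  have e : (j + (n - i))%:R * h = j%:R * h + (1 - a) - i%:R * h by rewrite jn !mulrDl nh mulNr.
  rewrite /rotation e !ifF; first by ring.
    by apply/negbTE; rewrite -leNgt; lra.
  by apply/negbTE; rewrite -leNgt.
rewrite -{2}(add0n i) big_addn.
apply: eq_big_nat => j /andP[_ ji]; congr q.
have e : (j + i)%:R * h = j%:R * h + i%:R * h by rewrite natrD mulrDl.
have ji' : (j + i).+1%:R * h <= n%:R * h.
  by rewrite ler_pM2r// ler_nat addnC -ltn_subRL.
move: ji'; rewrite -natr1 mulrDl mul1r e nh => ji'.
rewrite /rotation ifF; last by apply/negbTE; rewrite -leNgt.
rewrite ifT; last by lra.
by ring.
Qed.

Section Rearrangement.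
Context {d : measure_display} {T : measurableType d} {R : realType}
  (P : probability T R).
Hypothesis HP : atomless P.
Local Notation mu := (@lebesgue_measure R).
Local Notation U := (uniform_rv P).

Lemma pr_uniform_lt (x : R) : 0 <= x -> pr P [set w | U w < x] = Num.min x 1.
Proof.
move=> x0; have mlt := measurable_uniform_rv_lt HP.
have [->|x0'] := eqVneq x 0.
  rewrite (_ : [set w | _] = set0) ?pr0; first by rewrite min_l.
  apply/seteqP; split=> // w /= /(uniform_rv_lt P)[n [k [+ _]]].
  by rewrite ltNge divr_ge0// exprn_ge0.
have x0'' : 0 < x by rewrite lt_neqAle eq_sym x0'.
have [x1|x1] := leP x 1; first by rewrite pr_uniform_rv_lt// x0''.
apply/eqP; rewrite eq_le -{1}(prT P) le_pr//=.
rewrite -[leLHS](pr_uniform_rv_lt HP (x := 1)) ?lexx ?ltr01//.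
by apply: le_pr => // w /= /lt_trans; exact.
Qed.

(** Beyond [a], the event is the disjoint union of the two pieces given by [rotation_lt]. Their
    probabilities add up to [x] whether or not [x - e] reaches [a]. *)
Lemma rotation_uniform (a e x : R) : 0 <= a -> 0 <= e < 1 - a -> 0 < x <= 1 ->
  pr P [set w | rotation a e (U w) < x] = x.
Proof.
move=> a0 /andP[e0 ea] /andP[x0 x1]; have mlt := measurable_uniform_rv_lt HP.
have [xa|ax] := leP x a.
  rewrite (_ : [set w | _] = [set w | U w < x]).
    by rewrite pr_uniform_lt ?ltW// min_l.
  apply/seteqP; split=> w /=; rewrite /rotation.
    have [//|aw] := ltP (U w) a.
    by have [we|we] := ltP (U w) (1 - e); lra.
  by move=> wx; rewrite (lt_le_trans wx).
rewrite (_ : [set w | _] = [set w | U w < Num.max a (x - e)] `|`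
   ([set w | U w < x - e + (1 - a)] `\` [set w | U w < 1 - e])); last first.
  apply/seteqP; split=> w /=; rewrite rotation_lt ?e0 ?ax//.
    by move=> /orP[|/andP[? ?]]; [left|right; split => //; apply/negP; rewrite -leNgt].
  by move=> [->//|[-> /negP]]; rewrite -leNgt => ->; rewrite orbT.
have m1 : Num.max a (x - e) <= 1 - e by rewrite ge_max; lra.
rewrite prU//; last 2 first.
- exact: measurableD.
- rewrite -subset0 => w [/= w1 [_ /negP]]; rewrite -leNgt => w2.
  by have := lt_le_trans w1 m1; rewrite ltNge w2.
rewrite prD//; last by move=> w /= /lt_le_trans; apply; lra.
rewrite !pr_uniform_lt ?le_max ?a0//; [|lra..].
rewrite (min_l (_ : 1 - e <= 1)); last by lra.
rewrite (min_l (_ : Num.max a (x - e) <= 1)); last by lra.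
have [h|h] := leP a (x - e).
  by rewrite min_r; lra.
by rewrite min_l; lra.
Qed.

(** When [a <= U < 1], the mean of the copies is a Riemann sum of [q] with mesh [h]. All points but
    the first dominate the integral over []a, 1 - h[]; the last cell and the first point each cost
    less than half of the slack [E]. *)
Lemma rearrangement (X : T -> R) (a c r : R) : 0 <= a < 1 -> L1 P X ->
  (forall u, a <= u < 1 -> c <= quantile P X u) -> r < es P a X ->
  exists n (Y : nat -> T -> R), [/\ (0 < n)%N,
    forall k, measurable_fun setT (Y k),
    forall k, (k < n)%N -> same_law P (Y k) X &
    pr P [set t | n%:R^-1 * \sum_(0 <= k < n) Y k t <= r] <= a].
Proof.
move=> /andP[a0 a1] iX cq rX; have mX := L1_measurable iX.
set q := quantile P X; have iq := quantile_integrable iX; rewrite -/q in iq cq.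
have a1' : 0 < 1 - a by lra.
pose E := (1 - a) * (es P a X - r).
have E0 : 0 < E by rewrite mulr_gt0// subr_gt0.
(* The junk value 0 outside []0, 1[] makes [q] integrable on the line, where absolute continuity of
   the integral provides [dl]. *)
have iqT : mu.-integrable setT (EFin \o q).
  have := iq; rewrite integrable_mkcond//; apply: eq_integrable => // u _.
  rewrite /= patchE; case: ifPn => //; rewrite notin_setE/= in_itv/= => /negP/negbTE u01.
  by rewrite /q /quantile u01.
have E20 : 0 < E / 2 by rewrite divr_gt0.
have [dl [dl0 Hdl]] := integral_normr_continuous iqT E20.
(* The mesh will satisfy [h * K < 1]: the first summand then gives [h < dl], the second that [h]
   times the absolute value of [c] is below [E / 2]. *)
pose K := dl^-1 + 2 * `|c| / E.
have K1 : 0 < dl^-1 by rewrite invr_gt0.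
have K2 : 0 <= 2 * `|c| / E by apply: divr_ge0 (ltW E0); apply: mulr_ge0.
pose m := Num.trunc ((1 - a) * K).
pose h := (1 - a) / m.+1%:R.
have h0 : 0 < h by rewrite divr_gt0.
have nh : m.+1%:R * h = 1 - a by rewrite mulrC divfK.
have mh : m%:R * h = 1 - a - h by rewrite -nh -natr1; ring.
have hK : h * K < 1.
  by rewrite /h mulrAC ltr_pdivrMr// mul1r truncnS_gt.
have hdl : h < dl.
  by rewrite -(ltr_pM2r K1) divff ?gt_eqF// (le_lt_trans _ hK)// ler_wpM2l ?(ltW h0)// /K lerDl.
have hc : - (E / 2) < h * c.
  have : h * (2 * `|c| / E) < 1 by rewrite (le_lt_trans _ hK)// ler_wpM2l ?(ltW h0)// /K lerDr ltW.
  rewrite mulrA ltr_pdivrMr// mul1r => hcE.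
  have := ler_norm (- c); rewrite normrN => cc.
  have : h * - c <= h * `|c| by rewrite ler_wpM2l// ltW.
  by lra.
have tail : \int[mu]_(u in `]a, 1 - h[) q u > (1 - a) * es P a X - E / 2.
  have ah1 : a <= 1 - h by have := mulr_ge0 (ler0n R m) (ltW h0); lra.
  have : (1 - a) * es P a X = \int[mu]_(u in `]a, 1[) q u.
    by rewrite /es mulrA divff ?gt_eqF// mul1r.
  have h1 : 1 - h < 1 by lra.
  rewrite (Rintegral_itv_split iq a0 ah1 h1).
  have i1 := integrable_subitv iq (le_trans a0 ah1) (lexx 1).
  have := @le_normr_Rintegral _ (measurableTypeR R) R mu `]1 - h, 1[%classic q (measurable_itv _) i1.
  have muh : (mu `](1 - h)%R, 1%R[%classic < dl%:E)%E.
    by rewrite lebesgue_measure_itv/= lte_fin h1 -EFinB lte_fin opprB addrC subrK.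
  have := Hdl `]1 - h, 1[%classic (measurable_itv _) muh.
  have := ler_norm (\int[mu]_(u in `]1 - h, 1[) q u).
  by lra.
have avg u : a <= u < 1 ->
    r < m.+1%:R^-1 * \sum_(0 <= k < m.+1) q (rotation a (k%:R * h) u).
  move=> au1; have [v /andP[av vh] ->] := sum_rotation q h0 nh au1.
  rewrite big_ltn// mul0r addr0.
  have hS : \int[mu]_(u in `]a, 1 - h[) q u <= h * \sum_(1 <= j < m.+1) q (v + j%:R * h).
    have e : a + m%:R * h = 1 - h by rewrite mh; ring.
    rewrite -e; apply: (@riemann_lower _ q a 1) => //.
    - by rewrite e; lra.
    - exact: (integrable_subitv iq a0 (lexx 1)).
    - by move=> x y ax xy yv; apply: quantile_mono => //; lra.
  have := cq v; rewrite av /=; move: hS; move: (\sum_(1 <= j < m.+1) _) => S hS cv.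
  have v1 : v < 1 by have := mulr_ge0 (ler0n R m) (ltW h0); lra.
  have -> : m.+1%:R^-1 = h / (1 - a) by rewrite /h mulrAC divff ?mul1r// gt_eqF.
  rewrite mulrAC ltr_pdivlMr// [h * (_ + _)]mulrDr.
  have cqv : h * c <= h * q v by rewrite ler_wpM2l ?(ltW h0)// cv.
  have : E = (1 - a) * es P a X - r * (1 - a) by rewrite /E mulrBr (mulrC r).
  move: tail hc hS cqv; move: (E) (\int[mu]_(u in _) _) => e I.
  by lra.
have mlt := measurable_uniform_rv_lt HP.
exists m.+1, (fun k => q \o (rotation a (k%:R * h) \o U)).
have mR k : measurable_fun setT (rotation a (k%:R * h) \o U).
  by apply: measurableT_comp; [exact: measurable_rotation|exact: measurable_uniform_rv].
have mq k : measurable_fun setT (q \o (rotation a (k%:R * h) \o U)).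
  by apply: measurableT_comp; [exact: measurable_quantile|].
split => // [k kn|].
  apply: quantile_comp_law => //; apply: pr_lt_le => // x x01.
  apply: rotation_uniform => //; rewrite mulr_ge0 ?(ltW h0)//= -nh.
  by rewrite ltr_pM2r// ltr_nat.
(* The mean exceeds [r] on [a <= U < 1]. There remain [U < a], of probability [a], and the null
   event [U >= 1]. *)
apply: (@le_trans _ _ (pr P ([set w | U w < a] `|` (setT `\` [set w | U w < 1])))).
  apply: le_pr.
  - apply: measurable_le_cst; apply: measurable_funM => //.
    by apply: measurable_sum => k; exact: mq.
  - by apply: measurableU => //; exact: measurableD.
  move=> w /= wr; have [|aw] := ltP (U w) a; first by left.
  right; split => // w1.
  by have := avg (U w); rewrite aw w1 => /(_ isT); rewrite ltNge wr.
rewrite prU//; last 2 first.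
- exact: measurableD.
- by rewrite -subset0 => w [/= w1 [_]]; apply; rewrite (lt_trans w1).
by rewrite prD// prT !pr_uniform_lt ?ler01// minxx subrr addr0 ge_min lexx.
Qed.
End Rearrangement.

(** * Lambda-quantiles and the Lambda-expected shortfall *)

Section LambdaShortfall.
Context {d : measure_display} {T : measurableType d} {R : realType}
  (P : probability T R).
Implicit Types (X Y : T -> R) (L : R -> R).
Local Open Scope ereal_scope.

Lemma same_law_L1 X Y : measurable_fun setT Y -> same_law P Y X ->
  L1 P X -> L1 P Y.
Proof.
move=> mY YX iX; have mX := L1_measurable iX.
by have [] := integral_law_eq mX mY (fun B mB => esym (YX B mB)) (@measurable_id _ _ setT) iX.
Qed.

Lemma ES_same_law a X Y : same_law P X Y -> ES P a X = ES P a Y.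
Proof.
move=> XY; have cXY x : Defs.cdf P X x = Defs.cdf P Y x.
  have e Z : [set t | (Z t <= x)%R] = Z @^-1` `]-oo, x].
    by apply/seteqP; split => t /=; rewrite in_itv.
  rewrite /Defs.cdf (e _ X) (e _ Y); exact: (XY _ (measurable_itv _)).
have vXY b : VaR P b X = VaR P b Y.
  by rewrite /VaR; congr ereal_inf; congr image; apply/seteqP; split => x /=; rewrite cXY.
by rewrite /ES; case: ifP => // _; congr (_ * _); apply: eq_integral => b _.
Qed.

Lemma ES_ge_of_cdf X a x : (0 <= a < 1)%R -> L1 P X ->
  Defs.cdf P X x <= a%:E -> x%:E <= ES P a X.
Proof.
move=> /andP[a0 a1] iX ca; have mX := L1_measurable iX.
rewrite ES_es ?a0// lee_fin es_ge ?a0// => u /andP[au u1].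
have u0 : (0 < u)%R by exact: le_lt_trans au.
rewrite leNgt; apply/negP => /ltW; rewrite quantile_le ?u0// leNgt => /negP; apply.
by rewrite (le_lt_trans _ au)// -lee_fin -(cdfE P mX).
Qed.

(** If [r < VaRL P L X], then [P(X <= r) < L r], so the shortfall at level [L r] is at least [r] and
    the term of the supremum at [r] is [r]. *)
Lemma ESL_ge_VaRL L X : (forall x, 0 <= L x <= 1)%R -> L1 P X ->
  VaRL P L X <= ESL P L X.
Proof.
move=> L01 iX; rewrite leNgt; apply/negP => /ereal_between[r /andP[Er rV]].
move: Er; rewrite ltNge => /negP; apply.
apply: le_ereal_sup_tmp; exists (mine (ES P (L r) X) r%:E); first by exists r.
rewrite le_min lexx andbT.
have cL : Defs.cdf P X r < (L r)%:E.
  rewrite ltNge; apply/negP => h; move: rV; rewrite ltNge => /negP; apply.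
  by apply: ereal_inf_lbound; exists r.
have /andP[L0] := L01 r; rewrite le_eqVlt => /predU1P[L1|L1]; last first.
  by apply: ES_ge_of_cdf; rewrite ?L0// ltW.
rewrite L1 in cL *; rewrite /ES ltxx.
apply: le_ereal_inf_tmp => _ [y /= cy <-]; rewrite lee_fin leNgt; apply/negP => yr.
have mX := L1_measurable iX.
move: cy; rewrite leNgt => /negP; apply; apply: le_lt_trans cL.
by rewrite !cdfE// lee_fin; apply: Cdf_le => //; exact: ltW.
Qed.

Lemma ESL_ge_VaRpL L X : (forall x, 0 <= L x < 1)%R -> L1 P X ->
  VaRpL P L X <= ESL P L X.
Proof.
move=> L01 iX; rewrite leNgt; apply/negP => /ereal_between[r /andP[Er rV]].
move: Er; rewrite ltNge => /negP; apply.
apply: le_ereal_sup_tmp; exists (mine (ES P (L r) X) r%:E); first by exists r.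
rewrite le_min lexx andbT; apply: ES_ge_of_cdf => //.
rewrite leNgt; apply/negP => h; move: rV; rewrite ltNge => /negP; apply.
by apply: ereal_inf_lbound; exists r.
Qed.

Lemma ESL_quasi_convex L X Y g : (forall x, 0 <= L x <= 1)%R ->
  L1 P X -> L1 P Y -> (0 <= g <= 1)%R ->
  ESL P L (fun t => g * X t + (1 - g) * Y t)%R <= maxe (ESL P L X) (ESL P L Y).
Proof.
move=> L01 iX iY g01; apply: ge_ereal_sup => _ [x _ <-].
have sup Z : mine (ES P (L x) Z) x%:E <= ESL P L Z.
  by apply: ereal_sup_ubound; exists x.
have := ES_quasi_convex (L01 x) iX iY g01.
rewrite le_max => /orP[h|h]; rewrite le_max; apply/orP; [left|right];
  by apply: le_trans (sup _); rewrite le_min !ge_min h lexx orbT.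
Qed.

Lemma ESL_same_law L X Y : same_law P X Y -> ESL P L X = ESL P L Y.
Proof.
move=> XY; rewrite /ESL; congr ereal_sup; apply/seteqP.
by split => _ [x _ <-]; exists x => //; rewrite (ES_same_law _ XY).
Qed.

(** Each minimum is below each maximum, through [x <= y] or through monotonicity of the shortfall. A
    real [r] strictly between the two sides would have [ES P (L r) X < r], making the term of the
    infimum at [r] equal to [r]. *)
Lemma ESL_minimax L X : decreasing L -> (forall x, 0 <= L x <= 1)%R -> L1 P X ->
  ESL P L X = ereal_inf [set maxe (ES P (L x) X) x%:E | x in [set: R]].
Proof.
move=> dL L01 iX; have ESmono x y : (x <= y)%R -> ES P (L y) X <= ES P (L x) X.
  move=> xy; have /andP[L0 _] := L01 y; have /andP[_ L1x] := L01 x.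
  by apply: ES_mono => //; exact: dL.
apply/eqP; rewrite eq_le; apply/andP; split.
  apply: ge_ereal_sup => _ [x _ <-]; apply: le_ereal_inf_tmp => _ [y _ <-].
  rewrite ge_min !le_max !lee_fin; have [xy|yx] := leP x y; first by rewrite !orbT.
  by rewrite ESmono// ltW.
rewrite leNgt; apply/negP => /ereal_between[r /andP[Er rI]].
move: rI; rewrite ltNge => /negP; apply.
have : mine (ES P (L r) X) r%:E < r%:E.
  by apply: le_lt_trans Er; apply: ereal_sup_ubound; exists r.
rewrite gt_min ltxx orbF => ESr.
by apply: ge_ereal_inf; exists (maxe (ES P (L r) X) r%:E); [exists r|rewrite ge_max lexx ltW].
Qed.

(** By induction: the mean of [n.+2] variables combines the mean of the first [n.+1], with weight
    [n.+1 / n.+2], and the last one. *)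
Lemma quasi_convex_mean (D : (T -> R) -> Prop) (rho : (T -> R) -> \bar R) X
  (Y : nat -> T -> R) n :
  (forall X Y g, D X -> D Y -> (0 <= g <= 1)%R ->
    D (fun t => g * X t + (1 - g) * Y t)%R) ->
  quasi_convex_on D rho -> (0 < n)%N ->
  (forall k, (k < n)%N -> D (Y k) /\ rho (Y k) = rho X) ->
  let Z := (fun t => n%:R^-1 * \sum_(0 <= k < n) Y k t)%R in D Z /\ rho Z <= rho X.
Proof.
move=> cD qc; case: n => // n _; elim: n => [|n IH] DY Z.
  have -> : Z = Y 0%N by apply/funext => t; rewrite /Z big_nat1 invr1 mul1r.
  by have [? ->] := DY 0%N isT.
have [|DZ rZ] := IH; first by move=> k kn; apply: DY; exact: ltnW.
have [DY1 rY] := DY n.+1 (ltnSn _).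
pose g : R := (n.+1%:R / n.+2%:R)%R.
have g01 : (0 <= g <= 1)%R.
  by rewrite divr_ge0//= ler_pdivrMr// mul1r ler_nat.
have ZE : Z = (fun t => g * (n.+1%:R^-1 * \sum_(0 <= k < n.+1) Y k t) + (1 - g) * Y n.+1 t)%R.
  apply/funext => t; rewrite /Z big_nat_recr//= /g.
  have -> : (n.+2%:R = n.+1%:R + 1 :> R)%R by rewrite natr1.
  have : (0 < n.+1%:R :> R)%R by [].
  move: (n.+1%:R)%R => s s0; field.
  by rewrite !gt_eqF// ltr_wpDr.
rewrite ZE; split; first exact: cD.
by apply: (le_trans (qc _ _ DZ DY1 g g01)); rewrite ge_max rZ rY lexx.
Qed.

(** Left continuity in the level, which turns the later bound [P(Z <= r) <= b] into a strict one
    against [a]. *)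
Lemma ES_gt_lower_level X a r : (0 < a <= 1)%R -> L1 P X -> r%:E < ES P a X ->
  exists2 b, (0 < b < a)%R & (r < es P b X)%R.
Proof.
move=> /andP[a0]; rewrite le_eqVlt => /predU1P[->|a1] iX; have mX := L1_measurable iX.
  rewrite /ES ltxx => /ereal_between[s /andP[rs sV]].
  have cs : (Cdf P X s < 1)%R.
    rewrite -lte_fin -(cdfE P mX) ltNge; apply/negP => h.
    move: sV; rewrite ltNge => /negP; apply.
    by apply: ereal_inf_lbound; exists s.
  have /andP[c0 _] := Cdf01 P mX s.
  (* Above the level [Cdf P X s] all quantiles exceed [s > r]; the maximum with [1/2] keeps the
     level positive. *)
  exists (Num.max (Cdf P X s) (1/2))%R.
    by rewrite lt_max gt_max cs; apply/andP; split; [apply/orP; right|]; lra.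
  rewrite lte_fin in rs; apply: (lt_le_trans rs).
  apply: es_ge => //; first by rewrite le_max c0 gt_max cs; lra.
  move=> u /andP[]; rewrite gt_max => /andP[su hu] u1.
  by rewrite leNgt; apply/negP => /ltW; rewrite quantile_le//; lra.
rewrite ES_es ?(ltW a0)// lte_fin => rE.
pose c := quantile P X (a / 2); have a2 : (0 < a / 2)%R by lra.
pose e := ((1 - a) * (es P a X - r))%R; have e0 : (0 < e)%R by apply: mulr_gt0; lra.
(* Lowering the level by [dl] adds at least [c * dl] to the integral and [r * dl] to the threshold.
   The second bound on [dl] keeps the difference below the slack [e]; the first keeps the quantiles
   involved above [c]. *)
pose dl := (Num.min (a / 2) (e / (2 * (1 + `|c - r|))))%R.
have k0 : (0 < 2 * (1 + `|c - r|))%R by rewrite mulr_gt0// ltr_wpDr.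
have dl0 : (0 < dl)%R by rewrite lt_min a2 divr_gt0.
have dla : (dl <= a / 2)%R by rewrite ge_min lexx.
have dle : (dl * (2 * (1 + `|c - r|)) <= e)%R.
  by rewrite -ler_pdivlMr// ge_min lexx orbT.
exists (a - dl)%R; first by apply/andP; split; lra.
have iq := quantile_integrable iX.
have b0 : (0 <= a - dl)%R by lra.
have ba : (a - dl <= a)%R by lra.
have h1 := Rintegral_itv_split iq b0 ba a1.
have h2 : (c * (a - (a - dl)) <= \int[@lebesgue_measure R]_(u in `](a - dl)%R, a[) quantile P X u)%R.
  apply: (Rintegral_itv_ge iq b0 ba (ltW a1)) => u /andP[bu ua].
  by apply: quantile_mono => //; lra.
have h3 : ((1 - a) * es P a X = \int[@lebesgue_measure R]_(u in `]a, 1[) quantile P X u)%R.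
  by rewrite /es mulrA divff ?mul1r//; lra.
rewrite /es mulrC ltr_pdivlMr; last by lra.
rewrite h1 -h3; apply: (lt_le_trans _ (lerD h2 (lexx _))).
have : (- (dl * `|c - r|) <= dl * (c - r))%R.
  by rewrite -mulrN ler_wpM2l ?(ltW dl0)// lerNl -normrN ler_norm.
have : (dl * (2 * (1 + `|c - r|)) = 2 * dl + 2 * (dl * `|c - r|))%R by ring.
rewrite /e in dle e0; move: dle e0; rewrite !mulrBr !mulrBl !mul1r.
move: (dl * `|_|)%R => w; lra.
Qed.

(** * Minimality on an atomless space *)

Hypothesis HP : atomless P.

(** [Z] is the mean of the rearranged copies. The domain [D] is abstract in order to serve both [L1]
    and [L1b]. *)
Lemma admissible_rearrangement (D : (T -> R) -> Prop) (rho : (T -> R) -> \bar R) X a c r :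
  (forall X Y g, D X -> D Y -> (0 <= g <= 1)%R ->
    D (fun t => g * X t + (1 - g) * Y t)%R) ->
  (forall Y, measurable_fun setT Y -> same_law P Y X -> D Y) ->
  quasi_convex_on D rho -> law_invariant_on P D rho -> D X ->
  (0 <= a < 1)%R -> L1 P X ->
  (forall u, a <= u < 1 -> c <= quantile P X u)%R -> (r < es P a X)%R ->
  exists Z, [/\ D Z, measurable_fun setT Z, rho Z <= rho X & Defs.cdf P Z r <= a%:E].
Proof.
move=> cD lD qc li DX a01 iX cq rE.
have [n [Y [n0 mY lY avg]]] := rearrangement HP a01 iX cq rE.
have [|DZ rZ] := @quasi_convex_mean D rho X Y n cD qc n0.
  move=> k kn; have DY := lD _ (mY k) (lY k kn).
  by split => //; apply: li => //; exact: lY.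
exists (fun t => n%:R^-1 * \sum_(0 <= k < n) Y k t)%R.
have mZ : measurable_fun setT (fun t => n%:R^-1 * \sum_(0 <= k < n) Y k t)%R.
  by apply: measurable_funM => //; apply: measurable_sum => k; exact: mY.
by split => //; rewrite (cdfE P mZ) lee_fin.
Qed.

(** Any [r] below the term at [x] satisfies [r < x], hence [L x <= L r], and the shortfall at level
    [L r] exceeds [r] too. Only the level [L r] thus has to be treated. *)
Lemma ESL_le (rho : (T -> R) -> \bar R) L X : decreasing L ->
  (forall x, 0 <= L x <= 1)%R -> L1 P X ->
  (forall r, r%:E < ES P (L r) X -> r%:E <= rho X) -> ESL P L X <= rho X.
Proof.
move=> dL L01 iX H; apply: ge_ereal_sup => _ [x _ <-].
rewrite leNgt; apply/negP => /ereal_between[r /andP[Er]].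
rewrite lt_min lte_fin => /andP[rES rx]; move: Er; rewrite ltNge => /negP; apply.
apply: H; apply: (lt_le_trans rES).
have /andP[Lx0 _] := L01 x; have /andP[_ Lr1] := L01 r.
by apply: ES_mono => //; apply: dL; exact: ltW.
Qed.

(** With [P(Z <= r) <= b < L r], no [y < r] satisfies [L y <= P(Z <= y)], so [VaRL P L Z] is at
    least [r]. Since [b > 0], the quantile at [b] is a lower bound on [[b, 1[] even when [X] is
    unbounded. *)
Lemma le_rho_of_pos_level (D : (T -> R) -> Prop) (rho : (T -> R) -> \bar R) L X r :
  (forall X Y g, D X -> D Y -> (0 <= g <= 1)%R ->
    D (fun t => g * X t + (1 - g) * Y t)%R) ->
  (forall Y, measurable_fun setT Y -> same_law P Y X -> D Y) ->
  decreasing L -> (0 < L r <= 1)%R ->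
  dominates_on D rho (VaRL P L) -> quasi_convex_on D rho -> law_invariant_on P D rho ->
  D X -> L1 P X -> r%:E < ES P (L r) X -> r%:E <= rho X.
Proof.
move=> cD lD dL Lr dom qc li DX iX rES; have mX := L1_measurable iX.
have [b /andP[b0 bL] rb] := ES_gt_lower_level Lr iX rES.
have /andP[L0 L1'] := Lr.
have b01 : (0 <= b < 1)%R by rewrite (ltW b0) (lt_le_trans bL).
have cq u : (b <= u < 1)%R -> (quantile P X b <= quantile P X u)%R.
  by move=> /andP[bu u1]; exact: quantile_mono.
have [Z [DZ mZ rZ cZ]] := admissible_rearrangement cD lD qc li DX b01 iX cq rb.
apply: le_trans rZ; apply: le_trans (dom Z DZ).
apply: le_ereal_inf_tmp => _ [y /= Ly <-]; rewrite lee_fin leNgt; apply/negP => yr.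
have : (L y)%:E <= b%:E.
  apply: (le_trans Ly); apply: le_trans cZ.
  by rewrite !cdfE// lee_fin; apply: Cdf_le => //; exact: ltW.
by rewrite lee_fin leNgt => /negP; apply; apply: (lt_le_trans bL); apply: dL; exact: ltW.
Qed.

Lemma VaRL_le_VaRpL L X : VaRL P L X <= VaRpL P L X.
Proof. by apply: ereal_inf_le_tmp => _ [x /= Lx <-]; exists x => //=; exact: ltW. Qed.

(** * Random variables bounded from below *)

Lemma L1b_measure0 X c : measurable_fun setT X -> {ae P, forall t, (c <= X t)%R} <->
  P [set t | (X t < c)%R] = 0.
Proof.
move=> mX; have mlt := measurable_lt_cst c mX.
rewrite -(negligibleP P mlt) /=; split; apply: negligibleS => t /=; first by rewrite ltNge => /negP.
by move=> /negP; rewrite -ltNge.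
Qed.

Lemma L1b_same_law X Y : measurable_fun setT Y -> same_law P Y X -> L1b P X -> L1b P Y.
Proof.
move=> mY YX [iX [c cX]]; split; first exact: same_law_L1 YX iX.
exists c; apply/L1b_measure0 => //.
have e Z : [set t | (Z t < c)%R] = Z @^-1` `]-oo, c[.
  by apply/seteqP; split => t /=; rewrite in_itv.
move: cX => /L1b_measure0-/(_ (L1_measurable iX)) <-.
rewrite (e _ Y) (e _ X); exact: (YX _ (measurable_itv _)).
Qed.

Lemma L1b_comb X Y g : L1b P X -> L1b P Y -> (0 <= g <= 1)%R ->
  L1b P (fun t => g * X t + (1 - g) * Y t)%R.
Proof.
move=> [iX [c cX]] [iY [e eY]] /andP[g0 g1]; split; first exact: L1_comb.
exists (g * c + (1 - g) * e)%R; apply: filterS2 cX eY => t ct et.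
by apply: lerD; apply: ler_wpM2l => //; rewrite subr_ge0.
Qed.

Lemma L1b_quantile_ge X : L1b P X ->
  exists c, forall u, (0 <= u < 1 -> c <= quantile P X u)%R.
Proof.
move=> [iX [c cX]]; have mX := L1_measurable iX.
(* The minimum with 0 covers [u = 0], where [quantile] takes its junk value. *)
exists (Num.min c 0%R) => u /andP[]; rewrite le_eqVlt => /predU1P[<- _|u0 u1].
  by rewrite /quantile ltxx/= ge_min lexx orbT.
rewrite ge_min leNgt; apply/orP; left; apply/negP => qc.
have uF : (u <= Cdf P X (quantile P X u))%R by rewrite -quantile_le ?u0.
have : (Cdf P X (quantile P X u) <= pr P [set t | (X t < c)%R])%R.
  by apply: le_pr => [||t /= /le_lt_trans]; [exact: measurable_le_cst|exact: measurable_lt_cst|exact].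
have -> : pr P [set t | (X t < c)%R] = 0%R by rewrite /pr ((L1b_measure0 c mX).1 cX).
by rewrite leNgt (lt_le_trans u0).
Qed.

End LambdaShortfall.

Local Open Scope ereal_scope.

Theorem theorem6 (d : measure_display) (T : measurableType d) (R : realType)
  (P : probability T R) (HP : atomless P) :
  [/\ (forall L : R -> R, decreasing L -> (forall x, 0 < L x <= 1)%R ->
         is_min_admissible P (L1 P) (VaRL P L) (ESL P L)),
      (forall L : R -> R, decreasing L -> (forall x, 0 < L x < 1)%R ->
         is_min_admissible P (L1 P) (VaRpL P L) (ESL P L)),
      (forall L : R -> R, decreasing L -> (forall x, 0 <= L x < 1)%R ->
         is_min_admissible P (L1b P) (VaRpL P L) (ESL P L))
    & (forall L : R -> R, decreasing L -> (forall x, 0 <= L x <= 1)%R ->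
         forall X : T -> R, L1 P X ->
           ESL P L X = ereal_inf [set maxe (ES P (L x) X) x%:E | x in [set: R]])].
Proof.
have adm (D : (T -> R) -> Prop) f L : (forall X, D X -> L1 P X) ->
    (forall x, 0 <= L x <= 1)%R -> (forall X, L1 P X -> f X <= ESL P L X)%E ->
    admissible P D f (ESL P L).
  move=> DL1 L01 fE; split=> [X DX|X Y DX DY g g01|X Y DX DY XY].
  - exact/fE/DL1.
  - by apply: ESL_quasi_convex => //; exact: DL1.
  - exact: ESL_same_law.
have cL1 X Y g : L1 P X -> L1 P Y -> (0 <= g <= 1)%R ->
  L1 P (fun t => g * X t + (1 - g) * Y t)%R by move=> iX iY _; exact: L1_comb.
have lL1 X : L1 P X -> forall Y, measurable_fun setT Y -> same_law P Y X -> L1 P Y.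
  by move=> iX Y mY YX; exact: same_law_L1 YX iX.
split=> [L dL HL|L dL HL|L dL HL|L dL HL X iX]; last exact: ESL_minimax.
- have L01 x : (0 <= L x <= 1)%R by have := HL x; lra.
  split; first by apply: adm => // X; exact: ESL_ge_VaRL.
  move=> rho [dom qc li] X iX; apply: ESL_le => // r.
  by apply: (@le_rho_of_pos_level _ _ _ P HP (L1 P)) => //; exact: lL1.
- have L01 x : (0 <= L x <= 1)%R by have := HL x; lra.
  split; first by apply: adm => // X; apply: ESL_ge_VaRpL => x; have := HL x; lra.
  move=> rho [dom qc li] X iX; apply: ESL_le => // r.
  apply: (@le_rho_of_pos_level _ _ _ P HP (L1 P)) => //; first exact: lL1.
    by have := HL r; lra.
  (* Dominating [VaRpL] implies dominating [VaRL], so positive levels are settled as in the first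
     item. *)
  by move=> Y DY; apply: le_trans (dom Y DY); exact: VaRL_le_VaRpL.
have L01 x : (0 <= L x <= 1)%R by have := HL x; lra.
split.
  apply: adm => // [X []//|X]; exact: ESL_ge_VaRpL.
move=> rho [dom qc li] X bX; have iX := bX.1; apply: ESL_le => // r rES.
have cD := @L1b_comb _ _ _ P.
have lD Y mY YX := @L1b_same_law _ _ _ P X Y mY YX bX.
(* Level 0 cannot be lowered: the rearrangement takes place on the whole of [[0, 1[] and relies on
   the lower bound of [X]. *)
have [Lr0|Lr0] := eqVneq (L r) 0%R; last first.
  apply: (@le_rho_of_pos_level _ _ _ P HP (L1b P)) rES => //.
    by have := HL r; move: Lr0; lra.
  by move=> Y DY; apply: le_trans (dom Y DY); exact: VaRL_le_VaRpL.
have [c cq] := L1b_quantile_ge bX.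
have a01 : (0 <= (0 : R) < 1)%R by lra.
have rE : (r < es P 0 X)%R by move: rES; rewrite Lr0 ES_es// lte_fin.
have [Z [DZ mZ rZ cZ]] := admissible_rearrangement HP cD lD qc li bX a01 iX cq rE.
apply: le_trans rZ; apply: le_trans (dom Z DZ).
(* Some [y < r] in the set would give [L y < P(Z <= r) <= 0]; the strict inequality defining [VaRpL]
   is essential here. *)
apply: le_ereal_inf_tmp => _ [y /= Ly <-]; rewrite lee_fin leNgt; apply/negP => yr.
have : ((L y)%:E < 0%:E)%E.
  apply: (lt_le_trans Ly); apply: le_trans cZ.
  by rewrite !cdfE// lee_fin; apply: Cdf_le => //; exact: ltW.
by rewrite lte_fin ltNge; have /andP[-> _] := HL y.
Qed.
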